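(* (Double facet neck-cutting relation.) Let $F_1$ be a closed $GL(2)$ foam containing a double tube $\mathbb{S}^1\times[0,1]$ that is part of a double facet and bounds a solid cylinder whose interior is disjoint from $F_1$. Let $F$ be the foam obtained from $F_1$ by cutting this neck, i.e. removing the tube and capping off the two boundary circles by two parallel double disks (with the orientations induced from $F_1$). Then $\langle F\rangle=\rho\,\langle F_1\rangle$, where $\rho=-p_{12}p_{21}$.
   Context: $\mathbf{k}=\mathbb{Z}[\beta_{k,\ell}:k,\ell\ge0,(k,\ell)\ne(0,0)]$; $p(x,y)=1+\sum\beta_{k,\ell}x^ky^\ell$; $p_{12}=p(x_1,x_2)$, $p_{21}=p(x_2,x_1)$. A closed $GL(2)$ foam $F$ is a compact two-dimensional combinatorial CW-complex embedded in $\mathbb{R}^3$ whose only singularities are singular circles, with neighbourhood $\mathbb{S}^1\times$tripod; facets are thin or double, and along each singular circle two thin facets and one double facet meet. Facets are oriented so that at each singular circle the orientation of each adjacent thin facet agrees with that of the double facet across the circle; the circle is oriented by $t$, where $(v,t)$ is an oriented basis coming from a thin facet with $v$ pointing into the double facet. Thin facets may carry dots. A coloring $c$ maps thin facets to $\{1,2\}$ so that the two thin facets at each singular circle have different colors; double facets are colored $\{1,2\}$. $F_i(c)$ is the union of closed facets whose color is or contains $i$; $\chi_i(c)=\chi(F_i(c))$; $F_{12}$ is the union of thin facets; $d_i(c)$ is the number of dots on facets colored $i$; $\theta^+(c)$ is the number of positive singular circles, where a circle is positive if, looking in the direction of its orientation, the first thin facet met counterclockwise starting from the double facet is colored $1$.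 Evaluation: $\langle F\rangle=\sum_c\langle F,c\rangle$ over all colorings, with $$\langle F,c\rangle=(-1)^{\theta^+(c)+\chi_2(c)/2}\,\frac{x_1^{d_1(c)}x_2^{d_2(c)}p_{12}^{\chi_1(c)/2}p_{21}^{\chi_2(c)/2}}{(x_1-x_2)^{\chi(F_{12})/2}}\in\mathbf{k}\llbracket x_1,x_2\rrbracket\Bigl[\tfrac1{x_1-x_2}\Bigr].$$ *)

(* Defs.v *)
From HB Require Import structures.
From mathcomp Require Import all_boot all_order all_algebra finmap.
From mathcomp Require Import monalg.
From mathcomp Require Import all_classical all_reals all_analysis.

Set Implicit Arguments.
Unset Strict Implicit.
Unset Printing Implicit Defensive.

Import Order.TTheory GRing.Theory Num.Theory.
Import numFieldNormedType.Exports.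

Local Open Scope classical_set_scope.
Local Open Scope ring_scope.

(** ** Classical inverses in a commutative ring *)

Section ClassicalInverse.
Context (A : comNzRingType).

Definition cl_unit : pred A := fun a => `[< exists b, b * a = 1 >].
Definition cl_inv (a : A) : A :=
  if pselect (exists b, b * a = 1) is left ex then projT1 (cid ex) else a.

Lemma cl_mulVr : {in cl_unit, left_inverse 1 cl_inv *%R}.
Proof.
move=> a /asboolP ua; rewrite /cl_inv; case: pselect => // ex.
by case: (cid ex).
Qed.

Lemma cl_unitP (a b : A) : b * a = 1 -> cl_unit a.
Proof. by move=> ba; apply/asboolP; exists b. Qed.

Lemma cl_inv_out : {in [predC cl_unit], cl_inv =1 id}.
Proof.
by move=> a /negP; rewrite /cl_inv; case: pselect => // ex []; apply/asboolP.
Qed.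

End ClassicalInverse.

(** ** Formal power series in one variable *)

Record fps (A : Type) := FPS { fcoef : nat -> A }.

HB.instance Definition _ A := gen_eqMixin (fps A).
HB.instance Definition _ A := gen_choiceMixin (fps A).

Lemma fpsP A (f g : fps A) : fcoef f =1 fcoef g -> f = g.
Proof. by case: f g => f [g] /= /funext ->. Qed.

Section FpsRing.
Context (A : comNzRingType).
Implicit Types f g h : fps A.

Definition fps0 : fps A := FPS (fun=> 0).
Definition fps1 : fps A := FPS (fun n => (n == 0%N)%:R).
Definition fps_opp f : fps A := FPS (fun n => - fcoef f n).
Definition fps_add f g : fps A := FPS (fun n => fcoef f n + fcoef g n).
Definition fps_mul f g : fps A :=
  FPS (fun n => \sum_(i < n.+1) fcoef f i * fcoef g (n - i)).

Lemma fps_addA : associative fps_add.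
Proof. by move=> f g h; apply: fpsP => n /=; rewrite addrA. Qed.
Lemma fps_addC : commutative fps_add.
Proof. by move=> f g; apply: fpsP => n /=; rewrite addrC. Qed.
Lemma fps_add0 : left_id fps0 fps_add.
Proof. by move=> f; apply: fpsP => n /=; rewrite add0r. Qed.
Lemma fps_addN : left_inverse fps0 fps_opp fps_add.
Proof. by move=> f; apply: fpsP => n /=; rewrite addNr. Qed.

HB.instance Definition _ :=
  GRing.isZmodule.Build (fps A) fps_addA fps_addC fps_add0 fps_addN.

Let trunc N f : {poly A} := \poly_(i < N.+1) fcoef f i.

Let coef_trunc N f i : (i <= N)%N -> (trunc N f)`_i = fcoef f i.
Proof. by move=> iN; rewrite coef_poly ltnS iN. Qed.

Let fps_mulE N f g n : (n <= N)%N ->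
  fcoef (fps_mul f g) n = (trunc N f * trunc N g)`_n.
Proof.
move=> nN; rewrite coefM /=; apply: eq_bigr => -[i /=]; rewrite ltnS => ilt _.
rewrite !coef_trunc//; first exact: leq_trans (leq_subr _ _) nN.
exact: leq_trans ilt nN.
Qed.

Lemma fps_mulA : associative fps_mul.
Proof.
move=> f g h; apply: fpsP => n.
transitivity (trunc n f * (trunc n g * trunc n h))`_n.
  rewrite coefM /=; apply: eq_bigr => -[i /=]; rewrite ltnS => ilt _.
  by rewrite coef_trunc// -[in RHS]fps_mulE// leq_subr.
rewrite mulrA coefM /=; apply: eq_bigr => -[i /=]; rewrite ltnS => ilt _.
by rewrite -fps_mulE// coef_trunc// leq_subr.
Qed.

Lemma fps_mulC : commutative fps_mul.
Proof. by move=> f g; apply: fpsP => n; rewrite !(@fps_mulE n)// mulrC. Qed.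

Lemma fps_mul1 : left_id fps1 fps_mul.
Proof.
move=> f; apply: fpsP => n /=; rewrite big_ord_recl /= subn0 mul1r big1 ?addr0//.
by move=> i _; rewrite mul0r.
Qed.

Lemma fps_mulD : left_distributive fps_mul fps_add.
Proof.
move=> f g h; apply: fpsP => n /=; rewrite -big_split /=.
by apply: eq_bigr => i _; rewrite mulrDl.
Qed.

Lemma fps_1_neq0 : fps1 != 0.
Proof. by apply/eqP => /(congr1 (fun f => fcoef f 0%N)) /eqP; rewrite oner_eq0. Qed.

HB.instance Definition _ := GRing.Zmodule_isComNzRing.Build (fps A)
  fps_mulA fps_mulC fps_mul1 fps_mulD fps_1_neq0.

HB.instance Definition _ := GRing.ComNzRing_hasMulInverse.Build (fps A)
  (@cl_mulVr (fps A)) (@cl_unitP (fps A)) (@cl_inv_out (fps A)).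

End FpsRing.

Section FpsDomain.
Context (A : idomainType).

Let fps_val (f : fps A) : f != 0 ->
  exists2 n, fcoef f n != 0 & forall m, (m < n)%N -> fcoef f m = 0.
Proof.
move=> fN0; have ex : exists n, fcoef f n != 0.
  apply: contrapT => nex; move/eqP: fN0; apply; apply: fpsP => n /=.
  by apply: contrapT => fn; apply: nex; exists n; apply/eqP.
case: (ex_minnP ex) => n fn min; exists n => // m mn; apply/eqP.
by apply: contraTT mn => /min; rewrite -leqNgt.
Qed.

Lemma fps_domain : GRing.integral_domain_axiom (fps A).
Proof.
move=> f g fg0; apply/norP => -[/fps_val[m fm fm0] /fps_val[n gn gn0]].
have : fcoef (f * g) (m + n) = 0 by rewrite fg0.
rewrite /= (bigD1 (Ordinal (leq_addr n m : m < (m + n).+1)%N))//= addKn.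
rewrite big1 ?addr0 => [/eqP|i /negP ni]; first by rewrite mulf_eq0 (negbTE fm) (negbTE gn).
have [im|mi|im] := ltngtP i m; first by rewrite fm0 ?mul0r.
- by rewrite gn0 ?mulr0// ltn_subLR ?ltn_add2r// -ltnS.
- by case: ni; apply/eqP/val_inj.
Qed.

HB.instance Definition _ :=
  GRing.ComUnitRing_isIntegral.Build (fps A) fps_domain.

End FpsDomain.

(** ** Polynomial rings in arbitrarily many variables *)

Section MalgDomain.
Context (I : countType).
Implicit Types m : {cmonom I}.

Let mpol m : {poly int} := \sum_(i <- finsupp m) (m i)%:Z *: 'X^(choice.pickle i).

Let coef_mpol m i : (mpol m)`_(choice.pickle i) = (m i)%:Z.
Proof.
rewrite coef_sum; have [im|im] := boolP (i \in finsupp m).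
  rewrite (bigD1_seq i im (fset_uniq _)) coefZ coefXn eqxx mulr1.
  rewrite big1 => [|j ji]; first exact: addr0.
  rewrite coefZ coefXn (inj_eq (pcan_inj choice.pickleK)) eq_sym (negbTE ji).
  by rewrite mulr0.
rewrite big1_seq => [|j jm].
  by move: im; rewrite memNfinsupp => /eqP ->.
rewrite coefZ coefXn (inj_eq (pcan_inj choice.pickleK)).
by rewrite (_ : i == j = false) ?mulr0//; apply: contraNF im => /eqP ->.
Qed.

Let mpol_inj : injective mpol.
Proof.
move=> m m' e; apply/eqP/cmP => i.
by have := coef_mpol m i; rewrite e coef_mpol => -[].
Qed.

Let mpolM m m' : mpol (mmul m m') = mpol m + mpol m'.
Proof.
have mpolE (n : {cmonom I}) (d : {fset I}) : (finsupp n `<=` d)%fset ->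
    mpol n = \sum_(i <- d) (n i)%:Z *: 'X^(choice.pickle i).
  move=> nd; rewrite /mpol; apply: big_fset_incl => // i _.
  by rewrite memNfinsupp => /eqP ->; rewrite scale0r.
pose d := (finsupp m `|` finsupp m')%fset.
rewrite (mpolE _ d) ?mdomD// (mpolE m d) ?fsubsetUl// (mpolE m' d) ?fsubsetUr//.
by rewrite -big_split /=; apply: eq_bigr => i _; rewrite cmM PoszD scalerDl.
Qed.

(* A monoid morphism to the integers that separates finitely many monomials. *)
Let weight (d : {fset {cmonom I}}) : exists w : {cmonom I} -> int,
  (forall m m', w (mmul m m') = w m + w m') /\ {in d &, injective w}.
Proof.
pose q := \prod_(u <- d) \prod_(v <- d | u != v) (mpol u - mpol v).
have q0 : q != 0.
  rewrite prodf_seq_neq0; apply/allP => u _ /=.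
  rewrite prodf_seq_neq0; apply/allP => v _; apply/implyP => uv.
  by rewrite subr_eq0 (inj_eq mpol_inj).
have [N qN] : exists N : nat, q.[N%:Z] != 0.
  apply: contrapT => nex.
  have := @max_poly_roots _ q [seq n%:Z | n <- iota 0 (size q)] q0 _ _.
  rewrite size_map size_iota ltnn => roots; suff: false by [].
  apply: roots; last by rewrite map_inj_uniq ?iota_uniq// => ? ? [].
  apply/allP => _ /mapP[n _ ->]; apply: contrapT => qn.
  by apply: nex; exists n; apply/negP.
exists (fun m => (mpol m).[N%:Z]); split=> [m m'|u v ud vd uv].
  by rewrite mpolM hornerD.
apply/eqP; apply: contraNT qN => uNv.
rewrite /q horner_prod prodf_seq_eq0; apply/hasP; exists u => //=.
rewrite horner_prod prodf_seq_eq0; apply/hasP; exists v => //=.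
by rewrite uNv hornerD hornerN uv subrr eqxx.
Qed.

Lemma malg_domain (f g : {malg int[{cmonom I}]}) :
  f * g = 0 -> (f == 0) || (g == 0).
Proof.
move=> fg0; apply/norP => -[f0 g0].
have [w [wM winj]] := weight (msupp f `|` msupp g)%fset.
have top (h : {malg int[{cmonom I}]}) : h != 0 ->
    (msupp h `<=` msupp f `|` msupp g)%fset ->
  exists2 u, u \in msupp h & forall v, v \in msupp h -> v != u -> w v < w u.
  rewrite -msupp_eq0 => /fset0Pn[u0 u0h] hd.
  have [u _ umax] : exists2 u : msupp h, true &
      forall v : msupp h, w (val v) <= w (val u).
    case: (@arg_maxP _ _ _ [` u0h]%fset xpredT (fun v : msupp h => w (val v))) => //.
    by move=> u _ umax; exists u => // v; exact: umax.
  exists (val u) => [|v vh vu]; first exact: valP.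
  rewrite lt_neqAle (umax [` vh]%fset) andbT; apply: contraNneq vu => wvu.
  by apply/eqP/winj => //; apply: (fsubsetP hd) => //; exact: valP.
have [u uf umax] := top f f0 (fsubsetUl _ _).
have [v vg vmax] := top g g0 (fsubsetUr _ _).
have := congr1 (mcoeff (mmul u v)) fg0; rewrite mcoeff0 mcoeffMl.
have le1 u' : u' \in msupp f -> w u' <= w u.
  by move=> u'f; have [->//|/(umax _ u'f)/ltW] := eqVneq u' u.
have le2 v' : v' \in msupp g -> w v' <= w v.
  by move=> v'g; have [->//|/(vmax _ v'g)/ltW] := eqVneq v' v.
rewrite (big_fsetD1 u)//= (big_fsetD1 v)//= eqxx mulr1n.
rewrite [X in _ + X + _]big_seq [X in _ + X + _]big1 => [|v']; last first.
  rewrite in_fsetD1 => /andP[v'v v'g]; case: eqP => // e.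
  have := congr1 w e; rewrite !wM => /addrI e'.
  by have := vmax _ v'g v'v; rewrite e' ltxx.
rewrite addr0 big_seq [X in _ + X]big1 => [|u']; last first.
  rewrite in_fsetD1 => /andP[u'u u'f].
  rewrite big_seq big1// => v' v'g; case: eqP => // e.
  have := congr1 w e; rewrite !wM => e'.
  by have := ltr_leD (umax _ u'f u'u) (le2 _ v'g); rewrite e' ltxx.
rewrite addr0 => /eqP; rewrite mulf_eq0 => /orP[|]; apply/negP;
  by rewrite mcoeff_neq0.
Qed.

End MalgDomain.

(** ** The coefficient ring [k] *)

Definition beta_index := {kl : nat * nat | kl != (0, 0)%N}.

Definition kring := {malg int[{cmonom beta_index}]}.

HB.instance Definition _ := GRing.ComNzRing.on kring.
HB.instance Definition _ := GRing.ComNzRing_hasMulInverse.Build kring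
  (@cl_mulVr kring) (@cl_unitP kring) (@cl_inv_out kring).
HB.instance Definition _ := GRing.ComUnitRing_isIntegral.Build kring
  (@malg_domain beta_index).

(* [beta 0 0 = 1] is the constant term of [p]. *)
Definition beta (k l : nat) : kring :=
  if insub (k, l) is Some i then << ucm (i : beta_index) >> else 1.

(** ** The ring of evaluations *)

(* [ps2 a] is the series with [a k l] as coefficient of [x1 ^ k * x2 ^ l]; the
   ring of power series in [x1] and [x2] is that of the series in [x2] whose
   coefficients are series in [x1]. *)
Definition ps2 (a : nat -> nat -> kring) : fps (fps kring) :=
  FPS (fun l => FPS (fun k => a k l)).

(* Its localization at [x1 - x2], where the evaluations take their values, is a
   subring of the field of fractions. *)
Notation evalring := {fraction (fps (fps kring))}.

Definition x1 : evalring := tofrac (ps2 (fun k l => ((k, l) == (1, 0)%N)%:R)).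
Definition x2 : evalring := tofrac (ps2 (fun k l => ((k, l) == (0, 1)%N)%:R)).
Definition p12 : evalring := tofrac (ps2 (fun k l => beta k l)).
Definition p21 : evalring := tofrac (ps2 (fun k l => beta l k)).
Definition rho : evalring := - (p12 * p21).

(** ** Geometric simplicial complexes in three-space *)

Section Foams.
Context (R : realType).

Definition pt := 'rV[R]_3.

Implicit Types (s : {fset pt}) (x u v w : pt) (A B : set pt).

Definition hull s : set pt := [set x | exists a : pt -> R,
  [/\ forall p, p \in s -> 0 <= a p, \sum_(p <- s) a p = 1
    & x = \sum_(p <- s) a p *: p]].

Definition open_hull s : set pt := [set x | exists a : pt -> R,
  [/\ forall p, p \in s -> 0 < a p, \sum_(p <- s) a p = 1
    & x = \sum_(p <- s) a p *: p]].

(* An ordered triangle [(a, b, c)] carries the orientation of its plane in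
   which [(b - a, c - a)] is a positive basis. *)
Definition otri := (pt * pt * pt)%type.
Implicit Types t : otri.

Definition verts t : {fset pt} := let: (a, b, c) := t in [fset a; b; c]%fset.

Definition frame t : 'M[R]_(2, 3) :=
  let: (a, b, c) := t in \matrix_(i < 2) (if i == 0 then b - a else c - a).

(* The directed edges of the oriented boundary. *)
Definition dedges t : seq (pt * pt) :=
  let: (a, b, c) := t in [:: (a, b); (b, c); (c, a)].

(* [t] is the oriented triangle [u v w], up to cyclic rotation. *)
Definition rot_of t u v w := t \in [:: (u, v, w); (v, w, u); (w, u, v)].

(* Coplanar triangles with the same orientation of their common plane. *)
Definition same_orientation t t' := exists2 M : 'M[R]_2,
  frame t = M *m frame t' & 0 < \det M.

(** ** Foams *)

(* A triangulated foam: the oriented triangles of the thin facets, those of the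
   double facets, and the dots. *)
Record prefoam := Prefoam {
  thin : {fset otri};
  double : {fset otri};
  dots : seq pt }.

Implicit Types F : prefoam.

Definition triangles F : {fset otri} := (thin F `|` double F)%fset.

Definition carrier (T : {fset otri}) : set pt :=
  \bigcup_(t in [set` T]) hull (verts t).

Definition body F := carrier (triangles F).

Definition num_along (T : {fset otri}) u v : nat :=
  #|` [fset t in T | (u, v) \in dedges t]%fset|.

(* Number of thin triangles inducing on the edge [u v] the direction from [u]
   to [v], resp. from [v] to [u]; then the same for double triangles. *)
Definition edge_type F u v :=
  (num_along (thin F) u v, num_along (thin F) v u,
   num_along (double F) u v, num_along (double F) v u).

(* Two thin triangles and a double one meet along [u v], and the orientation of
   the double one agrees with that of each thin one across the edge.  If [e] is
   tangent to a thin triangle and points into the double one across the edge,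
   then [(e, v - u)] is a positive basis for the thin triangle, so the singular
   circle is oriented from [u] to [v]. *)
Definition singular_edge F u v := edge_type F u v = (2, 0, 0, 1)%N.

Definition singular_locus F : set pt :=
  [set x | exists u v, singular_edge F u v /\ hull [fset u; v]%fset x].

Definition vlink F v : {fset {fset pt}} :=
  [fset (verts t `\ v)%fset | t in triangles F & v \in verts t]%fset.

Definition walk_edges (p : seq pt) : {fset {fset pt}} :=
  [fset [fset e.1; e.2]%fset | e in zip p (behead p)]%fset.

Definition circle_graph (E : {fset {fset pt}}) := exists v (p : seq pt),
  [/\ uniq (v :: p), (2 <= size p)%N & E = walk_edges (v :: rcons p v)].

Definition theta_graph (E : {fset {fset pt}}) :=
  exists u v (p1 p2 p3 : seq pt),
  [/\ uniq (u :: v :: p1 ++ p2 ++ p3),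
      (count (@nilp _) [:: p1; p2; p3] <= 1)%N &
      E = (walk_edges (u :: rcons p1 v) `|` walk_edges (u :: rcons p2 v)
            `|` walk_edges (u :: rcons p3 v))%fset].

(* [foam_complex]: the triangles and their faces form a simplicial complex
   embedded in three-space.  [foam_edges]: facets are coherently oriented
   surfaces off the singular edges, where the foam looks as in [singular_edge].
   [foam_links]: away from the vertices with a circle as link, which are surface
   points, the foam is locally a tripod times an interval.  Since the two thin
   sheets and the double one occur in a fixed cyclic order around an oriented
   singular circle, the neighbourhood of the circle is then a product. *)
Record is_foam F : Prop := IsFoam {
  foam_disjoint : (thin F `&` double F = fset0)%fset;
  foam_nondegenerate : forall t, t \in triangles F -> row_free (frame t);
  foam_verts_inj : {in triangles F &, injective verts};
  foam_complex : forall t t', t \in triangles F -> t' \in triangles F ->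
    hull (verts t) `&` hull (verts t') = hull (verts t `&` verts t')%fset;
  foam_edges : forall u v, edge_type F u v \in
    [:: (0, 0, 0, 0); (1, 1, 0, 0); (0, 0, 1, 1); (2, 0, 0, 1); (0, 2, 1, 0)]%N;
  foam_links : forall t v, t \in triangles F -> v \in verts t ->
    circle_graph (vlink F v) \/ theta_graph (vlink F v);
  foam_dots : forall x, x \in dots F ->
    (carrier (thin F) `\` singular_locus F) x }.

Record foam := Foam { foam_data :> prefoam; foamP : is_foam foam_data }.

Definition components_of A : set (set pt) := connected_component A @` A.

Definition facets F := components_of (body F `\` singular_locus F).

Definition thin_facets F := facets F `&` [set C | C `<=` carrier (thin F)].

Definition double_facets F := facets F `&` [set C | C `<=` carrier (double F)].

Definition singular_circles F := components_of (singular_locus F).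

(** ** Finiteness of the set of facets and of singular circles *)

Lemma finite_components_of (I : choiceType) (D : {fset I}) (B : I -> set pt) A :
  A = \bigcup_(i in [set` D]) B i -> (forall i, i \in D -> connected (B i)) ->
  finite_set (components_of A).
Proof.
move=> AB cB; pose rep i := connected_component A (xget 0 (B i)).
apply: (sub_finite_set _ (finite_image rep (finite_fset D))) => _ [x Ax <-].
move: (Ax); rewrite {1}AB => -[i Di Bx]; exists i => //.
have By : B i (xget 0 (B i)) by case: xgetP => // /(_ x).
have BA : B i `<=` A by rewrite AB => z Bz; exists i.
rewrite /rep; apply/same_connected_component.
by apply: (connected_component_max By BA (cB _ Di)).
Qed.

Lemma segment_connected x y :
  connected [set k *: x + (1 - k) *: y | k in `[0, 1]].
Proof.
apply: connected_continuous_connected; first exact: segment_connected.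
apply: continuous_subspaceT => k.
apply: cvgD; apply: cvgZr_tmp; first exact: cvg_id.
by apply: cvgB; [exact: cvg_cst|exact: cvg_id].
Qed.


Lemma sum_extend (V : nmodType) s s' (f g : pt -> V) : (s `<=` s')%fset ->
  {in s, f =1 g} -> (forall p, p \notin s -> f p = 0) ->
  \sum_(p <- s') f p = \sum_(p <- s) g p.
Proof.
move=> ss' fg f0; rewrite -(big_fset_incl _ ss') => [|p _ /f0 //].
exact: eq_big_seq.
Qed.

Lemma hull_sub s s' : (s `<=` s')%fset -> hull s `<=` hull s'.
Proof.
move=> ss' x [a [a0 a1 xa]]; exists (fun p => if p \in s then a p else 0).
split=> [p ps'||]; first by case: ifPn => // /a0.
- by rewrite -[RHS]a1; apply: sum_extend => // p; [move=> ->|move=> /negbTE ->].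
- rewrite xa; apply/esym/sum_extend => // p; first by move=> ->.
  by move=> /negbTE ->; rewrite scale0r.
Qed.

Lemma open_hull_sub s : open_hull s `<=` hull s.
Proof. by move=> x [a [a0 a1 xa]]; exists a; split=> // p /a0 /ltW. Qed.

Lemma hull_convex s x y (k : R) : hull s x -> hull s y -> 0 <= k <= 1 ->
  hull s (k *: x + (1 - k) *: y).
Proof.
move=> [a [a0 a1 xa]] [b [b0 b1 yb]] /andP[k0 k1].
exists (fun p => k * a p + (1 - k) * b p); split.
- by move=> p ps; rewrite addr_ge0// mulr_ge0// ?a0 ?b0// subr_ge0.
- by rewrite big_split/= -!mulr_sumr a1 b1 !mulr1 addrC subrK.
- rewrite xa yb !scaler_sumr -big_split/=.
  by apply: eq_bigr => p _; rewrite [RHS]scalerDl !scalerA.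
Qed.

Lemma hull_open_hull s x y (k : R) : hull s x -> open_hull s y -> 0 <= k < 1 ->
  open_hull s (k *: x + (1 - k) *: y).
Proof.
move=> [a [a0 a1 xa]] [b [b0 b1 yb]] /andP[k0 k1].
exists (fun p => k * a p + (1 - k) * b p); split.
- move=> p ps; rewrite ltr_wpDl ?mulr_ge0 ?a0//.
  by rewrite mulr_gt0 ?b0// subr_gt0.
- by rewrite big_split/= -!mulr_sumr a1 b1 !mulr1 addrC subrK.
- rewrite xa yb !scaler_sumr -big_split/=.
  by apply: eq_bigr => p _; rewrite [RHS]scalerDl !scalerA.
Qed.

Lemma open_hull_neq0 s : s != fset0 -> exists x, open_hull s x.
Proof.
move=> /fset0Pn[q qs]; pose n := #|` s|.
have n0 : 0 < n%:R :> R by rewrite ltr0n cardfs_gt0; apply/fset0Pn; exists q.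
exists (\sum_(p <- s) n%:R^-1 *: p); exists (fun=> n%:R^-1); split=> //.
  by move=> p _; rewrite invr_gt0.
by rewrite big_const_seq count_predT iter_addr addr0 -[LHS]mulr_natr mulVf// gt_eqF.
Qed.

Lemma frame_indep p q r (k l : R) : row_free (frame (p, q, r)) ->
  k *: (q - p) + l *: (r - p) = 0 -> k = 0 /\ l = 0.
Proof.
move=> free kl0; pose w : 'rV[R]_2 := \row_i (if i == 0 then k else l).
have : w = 0.
  apply: (row_free_inj free); rewrite mul0mx -[RHS]kl0.
  by apply/rowP => j; rewrite !mxE !big_ord_recl big_ord0 addr0 !mxE.
by move=> /rowP w0; have := w0 0; have := w0 1; rewrite !mxE.
Qed.

Lemma big_verts (V : nmodType) p q r (f : pt -> V) : row_free (frame (p, q, r)) ->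
  \sum_(x <- verts (p, q, r)) f x = f p + f q + f r.
Proof.
move=> free.
have qp : q != p.
  apply/eqP => qp; have [|/eqP] := @frame_indep p q r 1 0 free;
    last by rewrite oner_eq0.
  by rewrite qp subrr scaler0 scale0r addr0.
have rp : r != p.
  apply/eqP => rp; have [|_ /eqP] := @frame_indep p q r 0 1 free;
    last by rewrite oner_eq0.
  by rewrite rp subrr scaler0 scale0r addr0.
have rq : r != q.
  apply/eqP => rq; have [|/eqP] := @frame_indep p q r 1 (-1) free;
    last by rewrite oner_eq0.
  by rewrite rq scaleN1r scale1r subrr.
rewrite (big_fsetD1 p) ?inE ?eqxx//= (big_fsetD1 q) ?inE ?eqxx ?qp ?orbT//=.
rewrite (big_fsetD1 r) ?inE ?eqxx ?rp ?rq ?orbT//= big1_seq ?addr0 ?addrA//.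
by move=> x; rewrite !inE; do 3 case: eqP => //.
Qed.

Lemma card_verts t : row_free (frame t) -> #|` verts t| = 3%N.
Proof. by case: t => [[p q] r] free; rewrite card_fset_sum1 big_verts. Qed.

Lemma verts_indep t (a : pt -> R) : row_free (frame t) ->
  \sum_(p <- verts t) a p = 0 -> \sum_(p <- verts t) a p *: p = 0 ->
  forall p, p \in verts t -> a p = 0.
Proof.
case: t => [[p q] r] free; rewrite !big_verts// => s0 c0.
have ap : a p = - (a q + a r) by apply/eqP; rewrite -addr_eq0 addrA s0.
have [] := frame_indep (k := a q) (l := a r) free.
  rewrite -[RHS]c0 ap scaleNr scalerDl !scalerBr.
  by rewrite addrACA -opprD addrC addrA.
move=> aq ar; rewrite aq ar addr0 oppr0 in ap.
by move=> x; rewrite !inE => /orP[/orP[]|] /eqP ->.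
Qed.

Lemma open_hull_face t s x : row_free (frame t) -> (s `<=` verts t)%fset ->
  open_hull (verts t) x -> hull s x -> s = verts t.
Proof.
move=> free st [a [a0 a1 xa]] [b [b0 b1 xb]]; apply/eqP.
rewrite eqEfsubset st/=; apply/fsubsetP => p pt_; apply: contraT => ps.
pose b' p := if p \in s then b p else 0.
have := @verts_indep t (fun p => a p - b' p) free _ _ p pt_.
rewrite /b' (negbTE ps) subr0 => ap0.
suff : a p = 0 by move=> ap; have := a0 _ pt_; rewrite ap ltxx.
apply: ap0; rewrite -/b'.
- rewrite sumrB a1 (sum_extend (g := b) st) ?b1 ?subrr// => q; rewrite /b'.
    by move=> ->.
  by move=> /negbTE ->.
- under eq_bigr do rewrite scalerBl.
  rewrite sumrB -xa (sum_extend (g := fun q => b q *: q) st) -?xb ?subrr//.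
    by move=> q; rewrite /b' => ->.
  by move=> q; rewrite /b' => /negbTE ->; rewrite scale0r.
Qed.

Lemma dedges_verts t u v : (u, v) \in dedges t -> ([fset u; v] `<=` verts t)%fset.
Proof.
case: t => [[a b] c]; rewrite !inE !xpair_eqE => h; apply/fsubsetP => x.
by rewrite !inE; case/or3P: h => /andP[/eqP -> /eqP ->] /orP[] ->; rewrite ?orbT.
Qed.

Lemma singular_edge_verts F u v : singular_edge F u v ->
  exists2 t, t \in triangles F & ([fset u; v] `<=` verts t)%fset.
Proof.
case=> n _ _ _; have : [fset t in thin F | (u, v) \in dedges t]%fset != fset0.
  by rewrite -cardfs_gt0; rewrite /num_along in n; rewrite n.
move=> /fset0Pn[t]; rewrite !inE => /andP[tT /dedges_verts uv].
by exists t => //; rewrite inE tT.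
Qed.

Lemma open_hull_singular F t x : is_foam F -> t \in triangles F ->
  open_hull (verts t) x -> ~ singular_locus F x.
Proof.
move=> okF tF ox [u [v [/singular_edge_verts[t' t'F uvt'] uvx]]].
have free := foam_nondegenerate okF tF.
have free' := foam_nondegenerate okF t'F.
have xI : hull (verts t `&` verts t')%fset x.
  rewrite -(foam_complex okF)//; split; first exact: open_hull_sub.
  exact: hull_sub uvx.
have tt' : (verts t `<=` verts t')%fset.
  by rewrite -(open_hull_face free _ ox xI) ?fsubsetIl// fsubsetIr.
have ett' : verts t = verts t'.
  by apply/eqP; rewrite eqEfcard tt' !card_verts.
rewrite -ett' in uvt'; have := open_hull_face free uvt' ox uvx.
move=> /(congr1 (fun s : {fset pt} => #|` s|)); rewrite card_verts// cardfs2.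
by case: (_ == _).
Qed.

Lemma finite_facets (F : foam) : finite_set (facets F).
Proof.
apply: (@finite_components_of _ (triangles F)
    (fun t => hull (verts t) `\` singular_locus F)).
  by rewrite /body /carrier setD_bigcupl.
move=> t tF.
have [b ob] : exists b, open_hull (verts t) b.
  apply: open_hull_neq0; case: (t) => [[p q] r].
  by apply/fset0Pn; exists p; rewrite !inE eqxx.
have nS := open_hull_singular (foamP F) tF.
have -> : hull (verts t) `\` singular_locus F =
    \bigcup_(x in hull (verts t) `\` singular_locus F)
      [set k *: x + (1 - k) *: b | k in `[0, 1]].
  apply/seteqP; split=> [x xA|_ [x [xt xS] [k + <-]]].
    exists x => //; exists 1; first by rewrite /= in_itv/= ler01 lexx.
    by rewrite scale1r subrr scale0r addr0.
  rewrite /= in_itv/= => /andP[k0]; rewrite le_eqVlt => /predU1P[->|k1].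
    by rewrite scale1r subrr scale0r addr0.
  have o := hull_open_hull xt ob (introT andP (conj k0 k1)).
  by split; [exact: open_hull_sub|exact: nS].
apply: bigcup_connected => [|x _]; last exact: segment_connected.
exists b => x _; exists 0; first by rewrite /= in_itv/= lexx ler01.
by rewrite scale0r add0r subr0 scale1r.
Qed.

Lemma finite_singular_circles (F : foam) : finite_set (singular_circles F).
Proof.
pose V := (\bigcup_(t <- triangles F) verts t)%fset.
pose D := [fset e in (V `*` V)%fset | `[< singular_edge F e.1 e.2 >]]%fset.
apply: (@finite_components_of _ D (fun e => hull [fset e.1; e.2]%fset)).
  apply/seteqP; split=> [x [u [v [uv xuv]]]|x [[u v]]] /=.
    exists (u, v) => //=; rewrite !inE/=; apply/andP; split; last exact/asboolP.
    have [t tF /fsubsetP uvt] := singular_edge_verts uv.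
    apply/andP; split; apply/bigfcupP; exists t; rewrite ?tF// uvt// !inE eqxx ?orbT//.
  by rewrite !inE/= => /andP[_ /asboolP uv] xuv; exists u, v.
move=> [u v] _ /=.
have [b ob] : exists b, hull [fset u; v]%fset b.
  have [|b ob] := @open_hull_neq0 [fset u; v]%fset.
    by apply/fset0Pn; exists u; rewrite !inE eqxx.
  by exists b; exact: open_hull_sub.
have -> : hull [fset u; v]%fset =
    \bigcup_(x in hull [fset u; v]%fset)
      [set k *: x + (1 - k) *: b | k in `[0, 1]].
  apply/seteqP; split=> [x xA|_ [x xt [k + <-]]].
    exists x => //; exists 1; first by rewrite /= in_itv/= ler01 lexx.
    by rewrite scale1r subrr scale0r addr0.
  by rewrite /= in_itv/= => k01; exact: hull_convex.
apply: bigcup_connected => [|x _]; last exact: segment_connected.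
exists b => x _; exists 0; first by rewrite /= in_itv/= lexx ler01.
by rewrite scale0r add0r subr0 scale1r.
Qed.

(** ** Colorings *)

(* A color for each thin facet, [true] for [1] and [false] for [2]; the set of
   facets is finite by [finite_facets]. *)
Definition precoloring F := {ffun fset_set (thin_facets F) -> bool}.

Definition tri_color F (c : precoloring F) t (i : bool) :=
  exists2 C, c C = i & open_hull (verts t) `<=` val C.

Definition is_coloring F (c : precoloring F) :=
  forall u v t t', singular_edge F u v ->
    t \in thin F -> t' \in thin F -> t != t' ->
    (u, v) \in dedges t -> (u, v) \in dedges t' ->
  forall i i', tri_color c t i -> tri_color c t' i' -> i != i'.

Definition colored_part F (c : precoloring F) (i : bool) : set pt :=
  \bigcup_(C in [set C | c C = i]) closure (val C)
  `|` \bigcup_(C in double_facets F) closure C.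

Definition num_dots F (c : precoloring F) (i : bool) : nat :=
  count (fun x => `[< exists2 C, c C = i & val C x >]) (dots F).

(** ** Positive singular circles *)

(* An observer looks in the direction of [t]; [e1] points to the right and [e2]
   upwards in the visual field, so that [(e1, e2, -t)] is a positive basis.
   Starting from the half-plane with edge [t] through [d] and turning
   counterclockwise, the half-plane through [a] is met before that through
   [b]. *)
Definition counterclockwise (t d a b : pt) :=
  exists e1 e2 : pt,
  [/\ e1 *m e1^T = 1%:M, e2 *m e2^T = 1%:M, e1 *m e2^T = 0,
      e1 *m t^T = 0 & e2 *m t^T = 0] /\
  \det (\matrix_(i < 3) [tuple e1; e2; - t]`_i) > 0 /\
  let ray (phi : R) (x : pt) := exists r q, 0 < r /\
    x = r *: (cos phi *: e1 + sin phi *: e2) + q *: t in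
  exists al be, 0 < al < be /\ be < 2 * pi /\
    [/\ ray 0 d, ray al a & ray be b].

Definition positive F (c : precoloring F) (Z : set pt) :=
  exists u v d a b td ta tb,
  [/\ singular_edge F u v /\ hull [fset u; v]%fset `<=` Z,
      [/\ td \in double F, ta \in thin F & tb \in thin F],
      [/\ rot_of td v u d, rot_of ta u v a & rot_of tb u v b],
      counterclockwise (v - u) (d - u) (a - u) (b - u) & tri_color c ta true].

Definition theta_plus F (c : precoloring F) : nat :=
  #|` fset_set [set Z | singular_circles F Z /\ positive c Z]|.

(** ** Euler characteristic of a subcomplex *)

Definition simplices F : {fset {fset pt}} :=
  (\bigcup_(t <- triangles F) (fpowerset (verts t) `\ fset0))%fset.

Definition euler F A : int :=
  \sum_(s <- simplices F | `[< hull s `<=` A >]) (-1) ^+ (#|` s|).-1.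

(** ** Evaluation *)

(* The surfaces [F_12] and [F_i(c)] are closed and orientable, hence of even
   Euler characteristic. *)
Definition half_euler F A : int := (euler F A %/ 2)%Z.

Definition eval_coloring F (c : precoloring F) : evalring :=
  let h1 := half_euler F (colored_part c true) in
  let h2 := half_euler F (colored_part c false) in
  let h12 := half_euler F (carrier (thin F)) in
  (-1) ^ ((theta_plus c)%:Z + h2) *
  (x1 ^+ num_dots c true * x2 ^+ num_dots c false * p12 ^ h1 * p21 ^ h2
     / (x1 - x2) ^ h12).

Definition foam_eval F : evalring :=
  \sum_(c : precoloring F | `[< is_coloring c >]) eval_coloring c.

(** ** Neck-cutting *)

Definition affine_on (f : pt -> pt) A := forall x y (k : R),
  A x -> A y -> 0 <= k <= 1 ->
  f (k *: x + (1 - k) *: y) = k *: f x + (1 - k) *: f y.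

Definition piecewise_linear_on (f : pt -> pt) A :=
  exists2 P : seq {fset pt}, A = \bigcup_(s in [set` P]) hull s
    & forall s, s \in P -> affine_on f (hull s).

(* The disk is modelled by a square. *)
Definition rad x : R := Num.max `|x 0 0| `|x 0 1|.
Definition height x : R := x 0 2%:R.

Definition solid_cylinder : set pt := [set x | rad x <= 1 /\ 0 <= height x <= 1].
Definition tube : set pt := [set x | rad x = 1 /\ 0 <= height x <= 1].
Definition open_tube : set pt := [set x | rad x = 1 /\ 0 < height x < 1].
Definition end_disks : set pt :=
  [set x | rad x <= 1 /\ (height x = 0 \/ height x = 1)].

(* [phi] embeds a solid cylinder whose lateral boundary lies in a double facet
   of [F] and which is otherwise disjoint from [F]. *)
Definition double_neck F (phi : pt -> pt) :=
  [/\ piecewise_linear_on phi solid_cylinder,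
      {in solid_cylinder &, injective phi},
      exists2 C, double_facets F C & phi @` tube `<=` C
    & body F `&` phi @` solid_cylinder `<=` phi @` tube].

(* [F] results from [F1] by cutting the neck [phi].  Both foams have the same
   orientation off the solid cylinder; since the facet of [F] containing an end
   disk continues beyond it, this fixes the orientation of the disks. *)
Definition neck_cut F1 (phi : pt -> pt) F :=
  [/\ carrier (thin F) = carrier (thin F1),
      carrier (double F) = (carrier (double F1) `\` phi @` open_tube)
                             `|` phi @` end_disks,
      forall t t1 x, t \in triangles F -> t1 \in triangles F1 ->
        open_hull (verts t) x -> open_hull (verts t1) x ->
        ~ (phi @` solid_cylinder) x -> same_orientation t t1
    & perm_eq (dots F) (dots F1)].

End Foams.

(* Main.v *)
From mathcomp Require Import all_boot all_order all_algebra finmap.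
From mathcomp Require Import all_classical all_reals all_analysis.
From mathcomp Require Import ring lra.
Require Import Defs.

Set Implicit Arguments.
Unset Strict Implicit.
Unset Printing Implicit Defensive.

Import Order.TTheory GRing.Theory Num.Theory.
Import numFieldNormedType.Exports.

Local Open Scope classical_set_scope.
Local Open Scope ring_scope.

(* The two foams carry unrelated triangulations, so everything entering the
   evaluation is first expressed by the sets [carrier (thin F)] and
   [carrier (double F)].  The singular locus is the intersection of the two; the
   thin facets are the components of the thin part off the singular locus; and a
   coloring is admissible iff both colors accumulate at every singular point.
   The neck is disjoint from the thin part, so all of this, as well as the
   positive singular circles, is the same for [F] and [F1].  A coloring thus
   contributes to both sums, and only the Euler characteristics of the colored
   surfaces differ.

   By Groemer's theorem, a linear relation between indicators of compact convex
   sets holds between their Euler characteristics; hence that of a triangulated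
   set does not depend on the triangulation, and piecewise linear embeddings
   preserve it.  Cutting the neck replaces a tube ([chi = 0]) by two disks
   ([chi = 2]): both [chi_1] and [chi_2] grow by [2], which multiplies each
   contribution by [- p12 * p21]. *)

(** * Hulls and convex sets *)

Section Hulls.
Context (R : realType).
Implicit Types (s : {fset pt R}) (x y : pt R) (A B : set (pt R)).

(** Positivity of a singular circle is witnessed by an edge and three triangles and has no evident
    description by sets, so it is moved between triangulations by local geometry. The two
    triangulations share a piece of an edge. From a point inside this piece one moves slightly
    towards the third vertex of each adjacent triangle, staying off the neck, which is closed. The
    triangle of the other foam found there lies in the same half-plane bounded by the edge, and the
    agreement of orientations on thin triangles shows that both edges run in the same direction.

    Euler characteristics are handled as integrals of integer-valued functions. The effect of the
    cut is the integral of one function on the model cylinder, end disks minus tube, pushed forward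
    by [phi] and extended by zero; this also accounts for the boundary circles shared with the rest
    of the surface. The function is first decomposed into convex sets on each of which [phi] is
    affine, so that their images are again compact and convex.

    The sign in [rho] comes from [chi_2 / 2] growing by one in the exponent of [-1]; the power of
    [x1 - x2] is unchanged because the thin part is. *)

Definition convexs A := forall x y (k : R),
  A x -> A y -> 0 <= k <= 1 -> A (k *: x + (1 - k) *: y).

(** The weights form a row vector instead of a function on points, so that a hull becomes the
    continuous image of a compact subset of ['rV[R]_n]. *)
Definition comb n (p : 'I_n -> pt R) (a : 'rV[R]_n) : pt R :=
  \sum_(i < n) a 0 i *: p i.

Definition std_simplex n : set 'rV[R]_n :=
  [set a | (forall i, 0 <= a 0 i) /\ \sum_(i < n) a 0 i = 1].

Lemma continuous_sumr n (T : topologicalType) (V : normedModType R)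
    (f : 'I_n -> T -> V) :
  (forall i, continuous (f i)) -> continuous (fun a => \sum_(i < n) f i a).
Proof.
move=> cf; have -> : (fun a => \sum_(i < n) f i a) = \sum_(i < n) f i.
  by apply/funext => a; rewrite fct_sumE.
elim/big_ind : _ => [|g h cg ch|i _]; [|exact: (fun a => cvgD (cg a) (ch a))|exact: cf].
by move=> a; exact: cvg_cst.
Qed.

Lemma comb_continuous n (p : 'I_n -> pt R) : continuous (comb p).
Proof.
apply: continuous_sumr => i a; apply: cvgZr_tmp; first exact: nbhs_filter.
exact: (@coord_continuous R 1 n 0 i a).
Qed.

Lemma std_simplex_compact n : compact (@std_simplex n).
Proof.
have cbox : compact [set v : 'rV[R]_n | forall i, v ord0 i \in `[0, 1]].
  exact: (@rV_compact _ n (fun=> `[(0 : R), 1]%classic)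
    (fun=> @segment_compact R 0 1)).
apply: subclosed_compact cbox _.
- have -> : @std_simplex n = (\bigcap_(i in [set: 'I_n])
      ((fun a : 'rV[R]_n => a 0 i) @^-1` [set t | 0 <= t])) `&`
      ((fun a : 'rV[R]_n => \sum_(i < n) a 0 i) @^-1` [set t | t = 1]).
    by apply/seteqP; split=> a [h1 h2]; split=> // i; [move=> _; exact: h1|exact: h1].
  apply: closedI.
    apply: closed_bigI => i _; apply: preimage_closed; last exact: closed_ge.
    by move=> a _; apply: coord_continuous.
  apply: preimage_closed; last exact: closed_eq.
  by move=> a _; apply: continuous_sumr => i; exact: coord_continuous.
- move=> a [a0 a1] i /=; rewrite in_itv/= a0/= -a1 (bigD1 i)//= lerDl.
  by apply: sumr_ge0 => j _; exact: a0.
Qed.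

Lemma hull_comb s : exists n (p : 'I_n -> pt R),
  (forall i, p i \in s) /\ hull s = comb p @` @std_simplex n.
Proof.
exists #|` s|, (tnth (in_tuple (enum_fset s))).
split; first by move=> i; apply: mem_tnth.
apply/seteqP; split=> [x [a [a0 a1 ->]]|_ [a [a0 a1] <-]].
- exists (\row_i a (tnth (in_tuple (enum_fset s)) i)); first split.
  + by move=> i; rewrite mxE; apply: a0; apply: mem_tnth.
  + by under eq_bigr do rewrite mxE; rewrite -a1 [RHS]big_tnth.
  + by rewrite /comb [RHS]big_tnth; apply: eq_bigr => i _; rewrite mxE.
(* The entries of [s] are distinct, so [index] inverts [tnth] and the row vector can be read back as
   a weight function; 0 is the default off [s]. *)
- pose b (p : pt R) := if insub (index p (enum_fset s)) is Some i then a 0 i else 0.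
  have bE i : b (tnth (in_tuple (enum_fset s)) i) = a 0 i.
    rewrite /b (tnth_nth 0)/= index_uniq ?fset_uniq//.
    by rewrite insubT//= => h; congr (a 0 _); apply/val_inj.
  exists b; split.
  + by move=> p ps; rewrite /b; case: insubP.
  + by rewrite big_tnth -a1; apply: eq_bigr => i _; exact: bE.
  + by rewrite [RHS]big_tnth /comb; apply: eq_bigr => i _; rewrite bE.
Qed.

Lemma hull_compact s : compact (hull s).
Proof.
have [n [p [_ ->]]] := hull_comb s.
apply: continuous_compact; last exact: std_simplex_compact.
by apply: continuous_subspaceT; exact: comb_continuous.
Qed.

Lemma compact_closed_pt A : compact A -> closed A.
Proof. by apply: compact_closed; exact: norm_hausdorff. Qed.

Lemma hull_closed s : closed (hull s).
Proof. by apply: compact_closed_pt; exact: hull_compact. Qed.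

Lemma hull_convexs s : convexs (hull s).
Proof. by move=> x y k; exact: hull_convex. Qed.

Lemma affine_on_comb (f : pt R -> pt R) A n (p : 'I_n -> pt R) a :
    convexs A -> affine_on f A -> (forall i, A (p i)) -> std_simplex a ->
  A (comb p a) /\ f (comb p a) = comb (f \o p) a.
Proof.
move=> cA fA; rewrite /comb /std_simplex; elim: n p a => [|n IH] p a Ap [a0 a1].
  by move: a1; rewrite big_ord0 => /eqP; rewrite eq_sym oner_eq0.
rewrite !big_ord_recl; move: a1; rewrite big_ord_recl => a1.
have k1 : 0 <= a 0 ord0 <= 1.
  by rewrite a0/= -a1 lerDl sumr_ge0.
have [a01|a0N1] := eqVneq (a 0 ord0) 1.
  have z i : a 0 (lift ord0 i) = 0.
    have /eqP : \sum_(i < n) a 0 (lift ord0 i) = 0.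
      by apply: (addrI (a 0 ord0)); rewrite a1 addr0 a01.
    by rewrite psumr_eq0// => /allP/(_ i); rewrite mem_index_enum => /(_ isT)/eqP.
  by rewrite a01 !scale1r !big1 ?addr0// => i _; rewrite z scale0r.
have kp : 0 < 1 - a 0 ord0.
  by rewrite subr_gt0 lt_neqAle a0N1; case/andP: k1.
pose b : 'rV[R]_n := \row_i (a 0 (lift ord0 i) / (1 - a 0 ord0)).
have [||h1 h2] := IH (p \o lift ord0) b; first by move=> i; exact: Ap.
  split; first by move=> i; rewrite mxE divr_ge0// ltW.
  under eq_bigr do rewrite mxE.
  rewrite -mulr_suml (_ : \sum_(i < n) _ = 1 - a 0 ord0) ?divff ?gt_eqF//.
  by apply/eqP; rewrite eq_sym subr_eq addrC a1.
have bE (q : 'I_n -> pt R) : \sum_(i < n) a 0 (lift ord0 i) *: q i =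
    (1 - a 0 ord0) *: \sum_(i < n) b 0 i *: q i.
  rewrite scaler_sumr; apply: eq_bigr => i _.
  by rewrite scalerA mxE mulrC divfK// gt_eqF.
rewrite !bE; split; first exact: cA.
by rewrite fA// h2.
Qed.

(* The map [f] need not be known to be continuous: [hull s `&` B] and its image
   are both parametrized by the same compact set of barycentric coordinates. *)
Lemma affine_image_compact (f : pt R -> pt R) s B :
  affine_on f (hull s) -> closed B -> compact (f @` (hull s `&` B)).
Proof.
move=> af clB; have [n [p [ps hE]]] := hull_comb s.
have hp i : hull s (p i).
  rewrite hE; exists (\row_j (j == i)%:R); first split.
  - by move=> j; rewrite mxE.
  - under eq_bigr do rewrite mxE.
    by rewrite (bigD1 i)//= eqxx big1 ?addr0// => j /negbTE ->.
  - rewrite /comb (bigD1 i)//= mxE eqxx scale1r big1 ?addr0// => j /negbTE ji.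
    by rewrite mxE ji scale0r.
have fE a : std_simplex a -> f (comb p a) = comb (f \o p) a.
  by move=> aD; have [_] := affine_on_comb (@hull_convexs s) af hp aD.
have -> : f @` (hull s `&` B) =
    comb (f \o p) @` (@std_simplex n `&` comb p @^-1` B).
  rewrite hE; apply/seteqP; split=> [_ [_ [[a aD <-] aB] <-]|_ [a [aD aB] <-]].
    by exists a => //; rewrite fE.
  by exists (comb p a); [split=> //; exists a|rewrite fE].
apply: continuous_compact.
  by apply: continuous_subspaceT; exact: comb_continuous.
apply: compact_closedI; first exact: std_simplex_compact.
by apply: preimage_closed => // a _; exact: comb_continuous.
Qed.

Lemma affine_image_convexs (f : pt R -> pt R) A B :
  affine_on f A -> B `<=` A -> convexs B -> convexs (f @` B).
Proof.
move=> af BA cB _ _ k [x Bx <-] [y By <-] k01.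
by exists (k *: x + (1 - k) *: y); [exact: cB|rewrite af//; exact: BA].
Qed.

Lemma near_seg x y (A : set (pt R)) : nbhs x A ->
  exists2 e : R, 0 < e < 1 & forall k, 0 < k <= e -> A ((1 - k) *: x + k *: y).
Proof.
move=> Ax; have : \forall k \near (0 : R), A ((1 - k) *: x + k *: y).
  have c : (fun k : R => (1 - k) *: x + k *: y) @ (0 : R) --> x.
    rewrite -[X in _ --> X](_ : (1 - 0 : R) *: x + (0 : R) *: y = x); last first.
      by rewrite subr0 scale1r scale0r addr0.
    apply: cvgD; apply: cvgZr_tmp; last exact: cvg_id.
    by apply: cvgB; [exact: cvg_cst|exact: cvg_id].
  exact: c.
move=> /nbhs_ballP[e /= e0 he]; exists (Num.min (e / 2) (1 / 2)).
  have h : 1 / 2 < 1 :> R by lra.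
  by rewrite lt_min gt_min h orbT andbT; apply/andP; split; lra.
move=> k /andP[k0]; rewrite le_min => /andP[ke _]; apply: he.
rewrite /ball/= sub0r normrN gtr0_norm// (le_lt_trans ke)//.
by rewrite ltr_pdivrMr// ltr_pMr// ltr1n.
Qed.

(** Moving from any point of the hull towards a point of [open_hull s] enters [open_hull s] at
    once. *)
Lemma hull_closure s : hull s `<=` closure (open_hull s).
Proof.
move=> x hx A Ax; have [y oy] : exists y, open_hull s y.
  apply: open_hull_neq0; apply/eqP => s0; case: hx => a [_ + _].
  by rewrite s0 big_seq_fset0 => /eqP; rewrite eq_sym oner_eq0.
have [e /andP[e0 e1] he] := near_seg y Ax.
exists ((1 - e) *: x + e *: y); split; last by apply: he; rewrite e0 lexx.
have := @hull_open_hull _ s x y (1 - e) hx oy; rewrite subKr; apply.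
by rewrite subr_ge0 (ltW e1)/= ltrBlDr ltrDl.
Qed.

Lemma star_connected A y : A y ->
  (forall x (k : R), A x -> 0 <= k <= 1 -> A (k *: x + (1 - k) *: y)) -> connected A.
Proof.
move=> Ay star.
have -> : A = \bigcup_(x in A) [set k *: x + (1 - k) *: y | k in `[0, 1]].
  apply/seteqP; split=> [x Ax|_ [x Ax [k + <-]]].
    exists x => //; exists 1; first by rewrite /= in_itv/= ler01 lexx.
    by rewrite scale1r subrr scale0r addr0.
  by rewrite /= in_itv/= => k01; exact: star.
apply: bigcup_connected => [|x _]; last exact: Defs.segment_connected.
exists y => x _; exists 0; first by rewrite /= in_itv/= lexx ler01.
by rewrite scale0r add0r subr0 scale1r.
Qed.

Lemma convexs_connected A : convexs A -> connected A.
Proof.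
move=> cA; have [->|/set0P[b Ab]] := eqVneq A set0; first exact: connected0.
by apply: (star_connected Ab) => x k Ax; exact: cA.
Qed.

End Hulls.

(** * The singular locus *)

Section Complexes.
Context (R : realType).
Implicit Types (s : {fset pt R}) (x y u v w : pt R) (t : otri R).

(** The vertices of a nondegenerate triangle are affinely independent, so barycentric coordinates
    are unique: a vertex with positive weight over [s] cannot be missing from [s']. *)
Lemma open_hull_face_sub t s s' x : row_free (frame t) ->
  (s `<=` verts t)%fset -> (s' `<=` verts t)%fset ->
  open_hull s x -> hull s' x -> (s `<=` s')%fset.
Proof.
move=> free st s't [a [a0 a1 xa]] [b [b0 b1 xb]].
apply/fsubsetP => p ps; apply: contraT => ps'.
pose a' p := if p \in s then a p else 0.
pose b' p := if p \in s' then b p else 0.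
have := @verts_indep _ t (fun p => a' p - b' p) free _ _ p (fsubsetP st p ps).
rewrite /a' /b' ps (negbTE ps') subr0 => ap0.
suff : a p = 0 by move=> ap; have := a0 _ ps; rewrite ap ltxx.
have ext (V : nmodType) (r : {fset pt R}) (g : pt R -> V) : (r `<=` verts t)%fset ->
  \sum_(p <- verts t) (if p \in r then g p else 0) = \sum_(p <- r) g p.
  by move=> rt; apply: sum_extend => // q; [move=> ->|move=> /negbTE ->].
apply: ap0.
- by rewrite sumrB !ext// a1 b1 subrr.
- under eq_bigr do rewrite scalerBl.
  rewrite sumrB.
  under eq_bigr do rewrite (fun_if (fun c => c *: _)) scale0r.
  under [X in _ - X]eq_bigr do rewrite (fun_if (fun c => c *: _)) scale0r.
  by rewrite !ext// -xa -xb subrr.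
Qed.

(** In a cyclically ordered triple any two distinct vertices are consecutive, in one order or the
    other. *)
Lemma dedgesP t u v : u != v -> u \in verts t -> v \in verts t ->
  (u, v) \in dedges t \/ (v, u) \in dedges t.
Proof.
case: t => [[a b] c]; rewrite !inE !xpair_eqE => uv.
move=> /orP[/orP[]|] /eqP uE /orP[/orP[]|] /eqP vE; rewrite uE vE ?eqxx ?orbT;
  (try by left); (try by right); by move: uv; rewrite uE vE eqxx.
Qed.

Lemma num_along_gt0 (T : {fset otri R}) t u v :
  t \in T -> (u, v) \in dedges t -> (0 < num_along T u v)%N.
Proof.
by move=> tT uvt; rewrite cardfs_gt0; apply/fset0Pn; exists t; rewrite !inE tT.
Qed.

Lemma num_alongP (T : {fset otri R}) u v : num_along T u v != 0%N ->
  exists2 t, t \in T & (u, v) \in dedges t.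
Proof.
by rewrite -lt0n cardfs_gt0 => /fset0Pn[t]; rewrite !inE => /andP[]; exists t.
Qed.

Lemma walk_edges_invariant (E : {fset {fset pt R}}) (Q : pt R -> Prop) x q :
    (forall y z, [fset y; z]%fset \in E -> Q y -> Q z) ->
    (walk_edges (x :: q) `<=` E)%fset ->
  forall y, y \in x :: q -> Q x <-> Q y.
Proof.
move=> QE; elim: q x => [|z q IH] x sub y.
  by rewrite inE => /eqP ->.
have zE e : e \in zip (z :: q) q -> [fset e.1; e.2]%fset \in E.
  move=> eq; apply: (fsubsetP sub); rewrite /walk_edges.
  by apply/imfsetP; exists e => //=; rewrite inE eq orbT.
have xz : [fset x; z]%fset \in E.
  apply: (fsubsetP sub); rewrite /walk_edges.
  by apply/imfsetP; exists (x, z) => //=; rewrite inE eqxx.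
have Qxz : Q x <-> Q z by split; apply: QE => //; rewrite fsetUC.
rewrite inE => /predU1P[->//|yq]; rewrite Qxz; apply: IH => //.
by apply/fsubsetP => _ /imfsetP[e /= eq ->]; exact: zE.
Qed.

Lemma mem_zip (T T' : eqType) (p : seq T) (q : seq T') a b :
  (a, b) \in zip p q -> a \in p /\ b \in q.
Proof.
elim: p q => [|x p IH] [|y q]//=; rewrite !inE => /predU1P[[-> ->]|/IH[-> ->]].
  by rewrite !eqxx.
by rewrite !orbT.
Qed.

Lemma walk_edges_mem (p : seq (pt R)) e z :
  e \in walk_edges p -> z \in e -> z \in p.
Proof.
move=> /imfsetP[[a b] /= ab ->]; rewrite !inE => /orP[] /eqP ->.
  by case: (mem_zip ab).
by case: (mem_zip ab) => _; exact: mem_behead.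
Qed.

(** Both kinds of graph are unions of walks from a common vertex, hence connected. Edges are
    unordered pairs, so a property passed along them travels in both directions. *)
Lemma link_graph_invariant (E : {fset {fset pt R}}) (Q : pt R -> Prop) :
    circle_graph E \/ theta_graph E ->
    (forall y z, [fset y; z]%fset \in E -> Q y -> Q z) ->
  forall e e' y z, e \in E -> e' \in E -> y \in e -> z \in e' -> Q y -> Q z.
Proof.
move=> gE QE; suff [x Qx] : exists x, forall e y, e \in E -> y \in e -> Q x <-> Q y.
  by move=> e e' y z eE e'E ye ze' Qy; apply/(Qx e' z e'E ze')/(Qx e y eE ye).
case: gE => [[v [p [_ _ EE]]]|[u [v [p1 [p2 [p3 [_ _ EE]]]]]]].
  exists v => e y eE ye; rewrite EE in eE.
  have sub : (walk_edges (v :: rcons p v) `<=` E)%fset by rewrite EE.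
  exact: (walk_edges_invariant QE sub (walk_edges_mem eE ye)).
exists u => e y eE ye.
have sub p : p \in [:: p1; p2; p3] -> (walk_edges (u :: rcons p v) `<=` E)%fset.
  move=> pp; apply/fsubsetP => f fp; rewrite EE !inE.
  by move: pp fp; rewrite !inE => /or3P[] /eqP -> ->; rewrite ?orbT.
have : exists2 p, p \in [:: p1; p2; p3] & e \in walk_edges (u :: rcons p v).
  move: eE; rewrite EE !inE -orbA => /or3P[] eE; [exists p1|exists p2|exists p3] => //;
    by rewrite !inE eqxx ?orbT.
move=> [p pp ep]; exact: (walk_edges_invariant QE (sub p pp) (walk_edges_mem ep ye)).
Qed.

Context (F : prefoam R) (okF : is_foam F).

(** Two triangles meet in the hull of their common vertices, so uniqueness of coordinates can be
    applied in each of them in turn. *)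
Lemma open_hull_complex t t' s s' x : t \in triangles F -> t' \in triangles F ->
  (s `<=` verts t)%fset -> (s' `<=` verts t')%fset ->
  open_hull s x -> hull s' x -> (s `<=` s')%fset.
Proof.
move=> tF t'F st s't' sx s'x.
have xI : hull (verts t `&` verts t')%fset x.
  rewrite -(foam_complex okF)//; split; last exact: hull_sub s'x.
  by apply: hull_sub st _ _; exact: open_hull_sub.
have sI := open_hull_face_sub (foam_nondegenerate okF tF) st (fsubsetIl _ _) sx xI.
apply: open_hull_face_sub (foam_nondegenerate okF t'F) _ s't' sx s'x.
exact: fsubset_trans sI (fsubsetIr _ _).
Qed.

Lemma thin_sub t : t \in thin F -> t \in triangles F.
Proof. by rewrite inE => ->. Qed.

Lemma double_sub t : t \in double F -> t \in triangles F.
Proof. by rewrite inE => ->; rewrite orbT. Qed.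

(** Of the five types in [foam_edges], only the two singular ones have both thin and double
    triangles. *)
Lemma edge_singular t d u v : t \in thin F -> d \in double F -> u != v ->
  u \in verts t -> v \in verts t -> u \in verts d -> v \in verts d ->
  singular_edge F u v \/ singular_edge F v u.
Proof.
move=> tT dD uv ut vt ud vd.
have ht : (0 < num_along (thin F) u v)%N \/ (0 < num_along (thin F) v u)%N.
  by have [/(num_along_gt0 tT)|/(num_along_gt0 tT)] := dedgesP uv ut vt; auto.
have hd : (0 < num_along (double F) u v)%N \/ (0 < num_along (double F) v u)%N.
  by have [/(num_along_gt0 dD)|/(num_along_gt0 dD)] := dedgesP uv ud vd; auto.
have := foam_edges okF u v; rewrite !inE /singular_edge /edge_type.
move=> /or4P[| | |/orP[]] /eqP[e1 e2 e3 e4]; move: ht hd;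
  rewrite e1 e2 e3 e4; case=> // _ [] // _; by [left|right].
Qed.

(** A thin and a double triangle cannot touch at an isolated vertex: the link of [v] is connected,
    and on the way from the thin part of the link to the double part some vertex lies on both,
    giving an edge at [v] that is thin and double. *)
Lemma vertex_singular t d v : t \in thin F -> d \in double F ->
  v \in verts t -> v \in verts d ->
  exists w, singular_edge F v w \/ singular_edge F w v.
Proof.
move=> tT dD vt vd; have tF := thin_sub tT; have dF := double_sub dD.
pose goal := exists w, singular_edge F v w \/ singular_edge F w v.
(* [Q] marks the link vertices joined to [v] by an edge of a thin triangle. At such a vertex a
   double triangle already yields [goal], and having [goal] as an alternative makes [Q] invariant
   along all edges of the link. *)
pose Q y := goal \/ exists t', [/\ t' \in thin F, v \in verts t' & y \in (verts t' `\ v)%fset].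
have linkP t' : t' \in triangles F -> v \in verts t' ->
    (verts t' `\ v)%fset \in vlink F v.
  by move=> t'F vt'; apply/imfsetP; exists t' => //=; rewrite inE t'F.
have nonempty t' : t' \in triangles F -> v \in verts t' ->
    exists y, y \in (verts t' `\ v)%fset.
  move=> t'F vt'; apply/fset0Pn; rewrite -cardfs_gt0.
  have := cardfsD1 v (verts t'); rewrite (card_verts (foam_nondegenerate okF t'F)) vt'.
  by rewrite add1n => -[<-].
have finish y d' : d' \in double F -> v \in verts d' -> y \in (verts d' `\ v)%fset ->
    Q y -> goal.
  move=> d'D vd' yd' [//|[t' [t'T vt' yt']]]; exists y.
  move: yd' yt'; rewrite !inE => /andP[yv yd'] /andP[_ yt'].
  by apply: (edge_singular t'T d'D) => //; rewrite eq_sym.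
have QE y z : [fset y; z]%fset \in vlink F v -> Q y -> Q z.
  move=> /imfsetP[t' /=]; rewrite !inE => /andP[t'F vt'] yzE Qy.
  have yt' : y \in (verts t' `\ v)%fset by rewrite -yzE !inE eqxx.
  have zt' : z \in (verts t' `\ v)%fset by rewrite -yzE !inE eqxx orbT.
  move/orP: t'F => [t'T|t'D]; first by right; exists t'.
  by left; exact: finish t'D vt' yt' Qy.
have [y yt] := nonempty t tF vt; have [z zd] := nonempty d dF vd.
apply: (finish z d) => //.
apply: (link_graph_invariant (foam_links okF tF vt) QE (linkP _ tF vt) (linkP _ dF vd) yt zd).
by right; exists t.
Qed.

(** A thin and a double triangle meet in the hull of their common vertices, whose number decides: a
    single vertex is an end of a singular edge, two span one, and three would make the triangles
    equal by [foam_verts_inj], against [foam_disjoint]. *)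
Lemma singular_locusE : singular_locus F = carrier (thin F) `&` carrier (double F).
Proof.
apply/seteqP; split=> [x [u [v [[n1 _ _ n4] xuv]]]|x [[t /= tT xt] [d /= dD xd]]].
  have [t tT /dedges_verts uvt] : exists2 t, t \in thin F & (u, v) \in dedges t.
    by apply: num_alongP; rewrite n1.
  have [d dD /dedges_verts uvd] : exists2 t, t \in double F & (v, u) \in dedges t.
    by apply: num_alongP; rewrite n4.
  split; [exists t|exists d] => //; first exact: hull_sub uvt _ _.
  by apply: hull_sub uvd _ _; rewrite fsetUC.
have xr : hull (verts t `&` verts d)%fset x.
  by rewrite -(foam_complex okF (thin_sub tT) (double_sub dD)).
move: xr; set r := (_ `&` _)%fset => xr.
have [r0|/fset0Pn[u ur]] := eqVneq r fset0.
  by case: xr => a [_ + _]; rewrite r0 big_seq_fset0 => /eqP; rewrite eq_sym oner_eq0.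
have [ut ud] : u \in verts t /\ u \in verts d by move: ur; rewrite inE => /andP.
have [r1|/fset0Pn[v]] := eqVneq (r `\ u)%fset fset0.
  have [w uw] := vertex_singular tT dD ut ud.
  have xu : hull [fset u]%fset x by rewrite -(fsetD1K ur) r1 fsetU0 in xr.
  by case: uw => uw; [exists u, w|exists w, u]; split=> //; apply: hull_sub xu;
    apply/fsubsetP => y; rewrite !inE => /eqP ->; rewrite eqxx ?orbT.
rewrite 2!inE => /andP[vu vr].
have [vt vd] : v \in verts t /\ v \in verts d by move: vr; rewrite inE => /andP.
have [r2|/fset0Pn[w]] := eqVneq (r `\ u `\ v)%fset fset0.
  have rE : r = [fset u; v]%fset.
    rewrite -(fsetD1K ur) -[in LHS](@fsetD1K _ v (r `\ u)%fset) ?r2 ?fsetU0//.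
    by rewrite !inE vu; move: vr; rewrite inE.
  rewrite rE in xr.
  have [|uv|vu'] := @edge_singular t d u v tT dD _ ut vt ud vd.
  - by rewrite eq_sym.
  - by exists u, v.
  - by exists v, u; rewrite fsetUC.
rewrite 4!inE => /and3P[wv wu wr].
have c3 : #|` [fset u; v; w]%fset| = 3%N.
  by rewrite fsetUC cardfsU1 cardfs2 !inE (negbTE wv) (negbTE wu) eq_sym vu.
have : (#|` [fset u; v; w]%fset| <= #|` r|)%N.
  apply: fsubset_leq_card; apply/fsubsetP => y yr.
  have : (y == u) || (y == v) || (y == w) by move: yr; rewrite !inE.
  by move=> /orP[/orP[]|] /eqP ->.
rewrite c3 => r3.
have et : r = verts t.
  by apply/eqP; rewrite eqEfcard fsubsetIl/= (card_verts (foam_nondegenerate okF (thin_sub tT))).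
have ed : r = verts d.
  by apply/eqP; rewrite eqEfcard fsubsetIr/= (card_verts (foam_nondegenerate okF (double_sub dD))).
have td : t = d.
  exact: (foam_verts_inj okF (thin_sub tT) (double_sub dD) (etrans (esym et) ed)).
have : t \in (thin F `&` double F)%fset by rewrite inE tT td.
by rewrite (foam_disjoint okF).
Qed.

End Complexes.

(** * Facets and colorings *)

Section Facets.
Context (R : realType).
Implicit Types (x y u v : pt R) (t : otri R) (A C : set (pt R)).

Lemma components_eq A C C' x :
  components_of A C -> components_of A C' -> C x -> C' x -> C = C'.
Proof.
move=> [y Ay <-] [z Az <-] yx zx.
by rewrite (same_connected_component yx) (same_connected_component zx).
Qed.

Lemma carrier_closed (T : {fset otri R}) : closed (carrier T).
Proof.
by apply: closed_bigcup => [|t _]; [exact: finite_fset|exact: hull_closed].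
Qed.

Lemma closure_subset_closed A C : closed C -> A `<=` C -> closure A `<=` C.
Proof. by move=> cC AC x /(closureS AC); exact: cC. Qed.

Lemma verts_neq0 t : verts t != fset0.
Proof. by case: t => [[a b] c]; apply/fset0Pn; exists a; rewrite !inE eqxx. Qed.

Lemma open_hull_verts t : exists x, open_hull (verts t) x.
Proof. exact/open_hull_neq0/verts_neq0. Qed.

Context (F : foam R).
Let S := singular_locus F.

Lemma open_hull_off_singular t : t \in triangles F ->
  open_hull (verts t) `<=` hull (verts t) `\` S.
Proof.
move=> tF x ox; split; first exact: open_hull_sub.
exact: open_hull_singular (foamP F) tF ox.
Qed.

(** The set is star-shaped about any point [b] of the open triangle: the points of a segment to [b]
    other than its start lie in the open hull, which misses [S]. *)
Lemma hull_off_singular_connected t : t \in triangles F ->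
  connected (hull (verts t) `\` S).
Proof.
move=> tF; have [b ob] := open_hull_verts t.
apply: (star_connected (open_hull_off_singular tF ob)) => x k [xt xS] /andP[k0].
rewrite le_eqVlt => /predU1P[->|k1]; first by rewrite scale1r subrr scale0r addr0.
by apply: open_hull_off_singular => //; apply: hull_open_hull; rewrite ?k0.
Qed.

Lemma card_fset_gt1P (K : choiceType) (A : {fset K}) : (1 < #|` A|)%N ->
  exists a b, [/\ a \in A, b \in A & a != b].
Proof.
move=> A1; have /fset0Pn[a aA] : A != fset0 by rewrite -cardfs_gt0 ltnW.
have /fset0Pn[b] : (A `\ a)%fset != fset0.
  by rewrite -cardfs_gt0; move: A1; rewrite (cardfsD1 a) aA.
by rewrite !inE => /andP[ba bA]; exists a, b; rewrite eq_sym.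
Qed.

Lemma card_fset2_mem (K : choiceType) (A : {fset K}) a b c : #|` A| = 2%N ->
  a != b -> a \in A -> b \in A -> c \in A -> c = a \/ c = b.
Proof.
move=> A2 ab aA bA cA; have /eqP AE : [fset a; b]%fset == A.
  by rewrite eqEfcard cardfs2 ab A2 andbT; apply/fsubsetP => d /fset2P[] ->.
by move: cA; rewrite -AE => /fset2P.
Qed.

Lemma dedges_neq t u v : row_free (frame t) -> (u, v) \in dedges t -> u != v.
Proof.
case: t => [[a b] c] free; apply: contraTneq => ->; apply/negP => vv.
have := card_verts free; rewrite /verts.
have : (#|` [fset a; b; c]%fset| < 3)%N; last by move=> /[swap] ->.
move: vv; rewrite !inE !xpair_eqE => /or3P[] /andP[/eqP <- /eqP <-].
- by rewrite fsetUid cardfs2; case: eqP.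
- by rewrite -fsetUA fsetUid cardfs2; case: eqP.
- by rewrite fsetUC fsetUA fsetUid cardfs2; case: eqP.
Qed.

Lemma bodyE : body F = carrier (thin F) `|` carrier (double F).
Proof.
apply/seteqP; split=> [x [t /= ]|x [] [t /= tF tx]].
- by rewrite inE => /orP[] tF tx; [left|right]; exists t.
- by exists t => //=; rewrite inE tF.
- by exists t => //=; rewrite inE tF orbT.
Qed.

Lemma triangle_facet t : t \in triangles F ->
  exists2 C, facets F C & hull (verts t) `\` S `<=` C.
Proof.
move=> tF; have [b /(open_hull_off_singular tF) hb] := open_hull_verts t.
have tB : hull (verts t) `\` S `<=` body F `\` S.
  by move=> x [tx xS]; split=> //; exists t.
exists (connected_component (body F `\` S) b); first by exists b => //; exact: tB.
by apply: connected_component_max => //; exact: hull_off_singular_connected.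
Qed.

(* Off [S], the thin and double parts are disjoint and relatively closed. *)
Lemma connected_thin C x : connected C -> C `<=` body F `\` S ->
  C x -> carrier (thin F) x -> C `<=` carrier (thin F).
Proof.
move=> cC CB Cx tx; suff <- : C `&` carrier (thin F) = C by move=> y [].
apply: cC; first by exists x.
- exists (~` carrier (double F)); first by rewrite openC; exact: carrier_closed.
  apply/seteqP; split=> y [Cy yt]; split=> //.
    by move=> yd; have [_] := CB _ Cy; apply; rewrite /S (singular_locusE (foamP F)).
  by have [] := CB _ Cy; rewrite bodyE => -[].
- by exists (carrier (thin F)) => //; exact: carrier_closed.
Qed.

Lemma connected_double C x : connected C -> C `<=` body F `\` S ->
  C x -> carrier (double F) x -> C `<=` carrier (double F).
Proof.
move=> cC CB Cx dx y Cy; have [] := CB _ Cy; rewrite bodyE => -[ty|//] _.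
have tx := connected_thin cC CB Cy ty Cx.
by have [_] := CB _ Cx; case; rewrite /S (singular_locusE (foamP F)).
Qed.

Lemma facet_sub C : facets F C -> connected C /\ C `<=` body F `\` S.
Proof.
move=> [x _ <-]; split; first exact: component_connected.
exact: connected_component_sub.
Qed.

(** By [connected_thin], a component of the body off [S] that meets the thin part stays inside it,
    so it is also a component of the thin part off [S]. *)
Lemma thin_facetsE : thin_facets F = components_of (carrier (thin F) `\` S).
Proof.
have TB : carrier (thin F) `\` S `<=` body F `\` S.
  by move=> x [tx xS]; split=> //; rewrite bodyE; left.
have same x : (carrier (thin F) `\` S) x ->
    connected_component (body F `\` S) x = connected_component (carrier (thin F) `\` S) x.
  move=> tx; apply/seteqP; split; apply: connected_component_max;
    [| |exact: component_connected| | |exact: component_connected].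
  - exact/connected_component_refl/TB.
  - move=> y xy; split; last by have [] := connected_component_sub xy.
    apply: (connected_thin _ _ _ _ xy); first exact: component_connected.
    + exact: connected_component_sub.
    + exact/connected_component_refl/TB.
    + by case: tx.
  - exact: connected_component_refl.
  - by apply: subset_trans TB; exact: connected_component_sub.
apply/seteqP; split=> [C [[x Bx xC] Ct]|C [x tx xC]].
  have tx : (carrier (thin F) `\` S) x.
    split; last by case: Bx.
    by apply: Ct; rewrite -xC; exact: connected_component_refl.
  by exists x => //; rewrite -same.
rewrite -same// in xC; split; first by exists x => //; exact: TB.
rewrite -xC; apply: (@connected_thin _ x); first exact: component_connected.
- exact: connected_component_sub.
- exact/connected_component_refl/TB.
- by case: tx.
Qed.

(** A facet is covered by the closed triangles whose open hulls it contains; there are finitely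
    many, so their union is closed and contains the closure. *)
Lemma facet_closure C x : facets F C -> closure C x <->
  exists t, [/\ t \in triangles F, open_hull (verts t) `<=` C & hull (verts t) x].
Proof.
move=> fC; split=> [xC|[t [tF tC tx]]]; last first.
  by apply: closureS tC _ _; exact: hull_closure.
pose D := [fset t in triangles F | `[< (open_hull (verts t) `<=` C)%classic >]]%fset.
have CD : C `<=` carrier D.
  move=> y Cy; have [_ /(_ _ Cy)[[t /= tF ty] yS]] := facet_sub fC.
  exists t => //=; rewrite 2!inE/= tF; apply/asboolP.
  have [C' fC' tC'] := triangle_facet tF.
  have -> : C = C' by apply: components_eq fC fC' Cy _; exact: tC'.
  by apply: subset_trans tC'; exact: open_hull_off_singular.
have [t /= tD tx] : carrier D x.
  exact: closure_subset_closed (@carrier_closed D) CD _ xC.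
exists t; move: tD; rewrite !inE => /andP[-> /asboolP]; split=> //.
Qed.

Lemma double_closures :
  \bigcup_(C in double_facets F) closure C = carrier (double F).
Proof.
apply/seteqP; split=> [x [C [fC Cd] Cx]|x [d /= dD dx]].
  exact: closure_subset_closed (@carrier_closed (double F)) Cd _ Cx.
have dF := double_sub dD; have [C fC dC] := triangle_facet dF.
exists C; last first.
  by apply: closureS (subset_trans (open_hull_off_singular dF) dC) _ (hull_closure dx).
split=> //; have [cC CB] := facet_sub fC.
have [b ob] := open_hull_verts d.
apply: (connected_double cC CB (x := b)).
  exact/dC/open_hull_off_singular.
by exists d => //; exact: open_hull_sub.
Qed.

Lemma finite_thin_facets : finite_set (thin_facets F).
Proof. by apply: sub_finite_set (finite_facets F) => C []. Qed.

Lemma thin_facet_val (C : fset_set (thin_facets F)) : thin_facets F (val C).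
Proof. by have := valP C; rewrite in_fset_set ?inE//; exact: finite_thin_facets. Qed.

Lemma thin_triangle_facet t : t \in thin F ->
  exists C : fset_set (thin_facets F), hull (verts t) `\` S `<=` val C.
Proof.
move=> tT; have tF := thin_sub tT; have [C fC tC] := triangle_facet tF.
have CT : C \in fset_set (thin_facets F).
  rewrite in_fset_set; last exact: finite_thin_facets.
  rewrite inE; split=> //; have [cC CB] := facet_sub fC.
  have [b ob] := open_hull_verts t.
  apply: (connected_thin cC CB (x := b)); first exact/tC/open_hull_off_singular.
  by exists t => //; exact: open_hull_sub.
by exists [` CT]%fset.
Qed.

Lemma thin_facet_inj (C C' : fset_set (thin_facets F)) x :
  val C x -> val C' x -> C = C'.
Proof.
move=> Cx C'x; apply/val_inj; have [fC _] := thin_facet_val C.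
by have [fC' _] := thin_facet_val C'; exact: components_eq fC fC' Cx C'x.
Qed.

Lemma tri_colorP (c : precoloring F) t i (C : fset_set (thin_facets F)) :
  open_hull (verts t) `<=` val C -> tri_color c t i <-> i = c C.
Proof.
move=> tC; split=> [[C' <- tC']|->]; last by exists C.
have [b ob] := open_hull_verts t.
by congr (c _); apply: (@thin_facet_inj _ _ b); [exact: tC'|exact: tC].
Qed.

Lemma open_hull2 u v : exists x, open_hull [fset u; v]%fset x.
Proof. by apply: open_hull_neq0; apply/fset0Pn; exists u; rewrite !inE eqxx. Qed.

Lemma thin_facet_triangle t (C : fset_set (thin_facets F)) : t \in triangles F ->
  open_hull (verts t) `<=` val C -> t \in thin F.
Proof.
move=> tF tC; have [_ CT] := thin_facet_val C.
move: (tF); rewrite inE => /orP[//|tD]; have [b ob] := open_hull_verts t.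
have [] := open_hull_off_singular tF ob; rewrite /S (singular_locusE (foamP F)) => bt [].
by split; [exact/CT/tC|exists t].
Qed.

(** The two thin triangles along a singular edge lie in facets of different colors, so both colors
    accumulate at every point of the edge. Conversely, were both of color [i], a facet of the other
    color accumulating at an inner point of the edge would supply a third thin triangle along it,
    while [singular_edge] allows two. *)
Lemma is_coloringP (c : precoloring F) : is_coloring c <->
  forall x i, S x -> exists2 C, c C = i & closure (val C) x.
Proof.
split=> [col x i [u [v [uv uvx]]]|col u v t t' uv tT t'T tt' ut ut'].
  have [n _ _ _] := uv.
  have [t [t' [tT t'T tt' ut ut']]] : exists t t', [/\ t \in thin F, t' \in thin F,
      t != t', (u, v) \in dedges t & (u, v) \in dedges t'].
    have : (1 < num_along (thin F) u v)%N by rewrite n.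
    move=> /card_fset_gt1P[t [t' [+ + tt']]].
    by rewrite !inE => /andP[? ?] /andP[? ?]; exists t, t'.
  have [C tC] := thin_triangle_facet tT; have [C' tC'] := thin_triangle_facet t'T.
  have oC := subset_trans (open_hull_off_singular (thin_sub tT)) tC.
  have oC' := subset_trans (open_hull_off_singular (thin_sub t'T)) tC'.
  have := col u v t t' uv tT t'T tt' ut ut' (c C) (c C') (proj2 (tri_colorP c _ oC) erefl)
    (proj2 (tri_colorP c _ oC') erefl).
  have xC : closure (val C) x.
    apply/facet_closure; first by case: (thin_facet_val C).
    by exists t; split=> //; [exact: thin_sub|exact: hull_sub (dedges_verts ut) _ _].
  have xC' : closure (val C') x.
    apply/facet_closure; first by case: (thin_facet_val C').
    by exists t'; split=> //; [exact: thin_sub|exact: hull_sub (dedges_verts ut') _ _].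
  have [<-|iC] := eqVneq (c C) i; first by exists C.
  by exists C' => //; move: (c C) (c C') i iC H => [] [] [].
move=> i i' ti t'i'; apply/eqP => ii'; rewrite -{i'}ii' in t'i'.
have [x ox] := open_hull2 u v.
have [] := col x (~~ i); first by exists u, v; split=> //; exact: open_hull_sub.
move=> C Ci /facet_closure[|s [sF sC xs]]; first by case: (thin_facet_val C).
have sT := thin_facet_triangle sF sC.
have uvs := open_hull_complex (foamP F) (thin_sub tT) sF (dedges_verts ut)
  (fsubset_refl _) ox xs.
have uNv := dedges_neq (foam_nondegenerate (foamP F) (thin_sub tT)) ut.
have [us|vs] : (u, v) \in dedges s \/ (v, u) \in dedges s.
- apply: dedgesP => //; apply: (fsubsetP uvs); rewrite !inE eqxx ?orbT//.
- have [n _ _ _] := uv.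
  have st : s = t \/ s = t'.
    by apply: (card_fset2_mem n tt'); rewrite !inE ?sT ?tT ?t'T.
  by case: st sC => -> sC; [move/(tri_colorP c i sC): ti|move/(tri_colorP c i sC): t'i'];
    move=> e; move: Ci; rewrite -e; case: (i).
- by have [_ n0 _ _] := uv; have := num_along_gt0 sT vs; rewrite n0.
Qed.

End Facets.

(** * Positivity of singular circles *)

Section Positivity.
Context (R : realType).
Implicit Types (x y u v w : pt R) (t : otri R) (A C : set (pt R)).

Definition mx2 (a b c d : R) : 'M[R]_2 :=
  \matrix_(i, j) if i == 0 then if j == 0 then a else b else if j == 0 then c else d.

Lemma det_mx2 a b c d : \det (mx2 a b c d) = a * d - b * c.
Proof.
rewrite (expand_det_row _ 0) big_ord_recl big_ord1 /cofactor !det_mx11 !mxE/=.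
by rewrite expr0 expr1 mul1r mulN1r mulrN.
Qed.

Lemma mx2_frame (k l m n : R) (a b c a' b' c' : pt R) :
  b' - a' = k *: (b - a) + l *: (c - a) ->
  c' - a' = m *: (b - a) + n *: (c - a) ->
  frame (a', b', c') = mx2 k l m n *m frame (a, b, c).
Proof.
move=> e1 e2; apply/matrixP => i j.
rewrite mxE mxE big_ord_recl big_ord1 !mxE /=.
case: i => -[|[|//]] i2 /=.
  by rewrite e1 !mxE.
by rewrite e2 !mxE.
Qed.

Lemma rot_frame t u v w : rot_of t u v w ->
  exists2 N : 'M[R]_2, frame t = N *m frame (u, v, w) & \det N = 1.
Proof.
rewrite /rot_of !inE => /or3P[] /eqP ->.
- exists (mx2 1 0 0 1); last by rewrite det_mx2; ring.
  by apply: mx2_frame; rewrite scale1r scale0r ?addr0 ?add0r.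
- exists (mx2 (-1) 1 (-1) 0); last by rewrite det_mx2; ring.
  by apply: mx2_frame; apply/rowP => j; rewrite !mxE; ring.
- exists (mx2 0 (-1) 1 (-1)); last by rewrite det_mx2; ring.
  by apply: mx2_frame; apply/rowP => j; rewrite !mxE; ring.
Qed.

Lemma rot_frame_sym t u v w : rot_of t u v w ->
  exists2 N : 'M[R]_2, frame (u, v, w) = N *m frame t & \det N = 1.
Proof.
case: t => [[a b] c] h; apply: rot_frame; move: h.
by rewrite /rot_of !inE => /or3P[] /eqP[-> -> ->]; rewrite eqxx ?orbT.
Qed.

Lemma rot_verts t u v w : rot_of t u v w -> verts t = [fset u; v; w]%fset.
Proof.
rewrite /rot_of !inE => /or3P[] /eqP -> /=; apply/fsetP => z; rewrite !inE//.
- by rewrite orbC orbA.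
- by rewrite -orbA orbC.
Qed.

Lemma rot_free t u v w : rot_of t u v w -> row_free (frame t) ->
  row_free (frame (u, v, w)).
Proof.
move=> /rot_frame[N -> _] /eqP rN; rewrite /row_free eqn_leq rank_leq_row/=.
by rewrite -[X in (X <= _)%N]rN mxrankM_maxr.
Qed.

Lemma dedges_rot t u v : (u, v) \in dedges t -> exists w, rot_of t u v w.
Proof.
case: t => [[a b] c]; rewrite /rot_of !inE => /or3P[] /eqP[-> ->];
  [exists c|exists a|exists b]; by rewrite !inE eqxx ?orbT.
Qed.

Lemma big_fset2 (V : nmodType) u v (f : pt R -> V) : u != v ->
  \sum_(p <- [fset u; v]%fset) f p = f u + f v.
Proof.
move=> uv; rewrite (big_fsetD1 u) ?inE ?eqxx//=.
rewrite (big_fsetD1 v) ?inE ?eqxx ?orbT ?andbT 1?eq_sym//=.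
rewrite big1_fset ?addr0// => x; rewrite !inE => /and3P[/negbTE -> /negbTE ->] //.
Qed.

Lemma big_fset3 (V : nmodType) u v w (f : pt R -> V) :
  #|` [fset u; v; w]%fset| = 3%N ->
  \sum_(p <- [fset u; v; w]%fset) f p = f u + f v + f w.
Proof.
have [->|uv] := eqVneq u v; first by rewrite fsetUid cardfs2; case: eqP.
move=> c3; have wuv : w \notin [fset u; v]%fset.
  apply/negP => wuv; move: c3; rewrite (fsetUidPl _ _ _) ?fsub1set//.
  by rewrite cardfs2; case: eqP.
rewrite fsetUC (big_fsetD1 w) ?inE ?eqxx//= fsetDUl fsetDv fset0U.
by rewrite mem_fsetD1// big_fset2// addrC.
Qed.

Lemma hull2P u v x : u != v -> hull [fset u; v]%fset x ->
  exists2 k : R, 0 <= k <= 1 & x = (1 - k) *: u + k *: v.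
Proof.
move=> uv [a [a0]]; rewrite !big_fset2// => a1 ->.
exists (a v); last by rewrite -a1 addrK.
by rewrite -[in X in _ && X]a1 lerDr !a0// !inE eqxx ?orbT.
Qed.

Lemma open_hull2P u v x : u != v -> open_hull [fset u; v]%fset x ->
  exists2 k : R, 0 < k < 1 & x = (1 - k) *: u + k *: v.
Proof.
move=> uv [a [a0]]; rewrite !big_fset2// => a1 ->.
exists (a v); last by rewrite -a1 addrK.
by rewrite -[in X in _ && X]a1 ltrDr !a0// !inE eqxx ?orbT.
Qed.

Lemma open_hull2I u v (k : R) : u != v -> 0 < k < 1 ->
  open_hull [fset u; v]%fset ((1 - k) *: u + k *: v).
Proof.
move=> uv /andP[k0 k1]; exists (fun p => if p == v then k else 1 - k).
rewrite !big_fset2// eqxx (negbTE uv) subrK; split=> // p _.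
by case: ifP; rewrite ?subr_gt0.
Qed.

Lemma hull2I u v (k : R) : u != v -> 0 <= k <= 1 ->
  hull [fset u; v]%fset ((1 - k) *: u + k *: v).
Proof.
move=> uv /andP[k0 k1]; exists (fun p => if p == v then k else 1 - k).
rewrite !big_fset2// eqxx (negbTE uv) subrK; split=> // p _.
by case: ifP; rewrite ?subr_ge0.
Qed.

Lemma hull3P u v w x : #|` [fset u; v; w]%fset| = 3%N ->
  hull [fset u; v; w]%fset x -> exists b c : R,
  [/\ 0 <= 1 - b - c, 0 <= b, 0 <= c & x = (1 - b - c) *: u + b *: v + c *: w].
Proof.
move=> c3 [a [a0]]; rewrite !big_fset3// => a1 ->; exists (a v), (a w).
have -> : 1 - a v - a w = a u by rewrite -a1; ring.
by split=> //; apply: a0; rewrite !inE eqxx ?orbT.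
Qed.

Lemma open_hull3I u v w (b c : R) : #|` [fset u; v; w]%fset| = 3%N ->
  0 < 1 - b - c -> 0 < b -> 0 < c ->
  open_hull [fset u; v; w]%fset ((1 - b - c) *: u + b *: v + c *: w).
Proof.
move=> c3 a0 b0 c0.
have [uv uw vw] : [/\ u != v, u != w & v != w].
  have c2 a d : #|` [fset a; d]%fset| != 3%N by rewrite cardfs2; case: (a == d).
  split; apply: contra_eq_neq c3 => ->.
  - by rewrite fsetUid.
  - by rewrite fsetUC fsetUA fsetUid.
  - by rewrite -fsetUA fsetUid.
exists (fun p => if p == w then c else if p == v then b else 1 - b - c).
rewrite !big_fset3// !eqxx (negbTE uw) (negbTE vw) (negbTE uv).
by split=> // [p _|]; [case: ifP => // _; case: ifP|ring].
Qed.

End Positivity.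

(** * Comparing two triangulations along the singular locus *)

Section Transfer.
Context (R : realType).
Implicit Types (x y u v w : pt R) (t : otri R) (A C : set (pt R)).

Lemma singular_edge_neq (F : foam R) u v : singular_edge F u v -> u != v.
Proof.
case=> n _ _ _; have [|t tT] := @num_alongP R (thin F) u v; first by rewrite n.
exact/dedges_neq/(foam_nondegenerate (foamP F))/thin_sub.
Qed.

Lemma finite_singular_edges (F : foam R) :
  finite_set [set e : pt R * pt R | singular_edge F e.1 e.2].
Proof.
pose V := (\bigcup_(t <- triangles F) verts t)%fset.
apply: sub_finite_set (finite_fset (V `*` V)%fset) => -[u v] /= uv.
have [t tF /fsubsetP uvt] := singular_edge_verts uv.
by rewrite !inE/=; apply/andP; split; apply/bigfcupP; exists t;
  rewrite ?tF// uvt// !inE eqxx ?orbT.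
Qed.

Lemma open_hull2_infinite u v : u != v -> infinite_set (open_hull [fset u; v]%fset).
Proof.
move=> uv; apply/infiniteP/pcard_leP/injfunPex.
exists (fun n => (1 - n.+2%:R^-1) *: u + n.+2%:R^-1 *: v).
  move=> n _; apply: open_hull2I => //.
  by rewrite invr_gt0 ltr0Sn/= invf_lt1 ?ltr0Sn// ltr1n.
move=> m n _ _ /eqP; rewrite -subr_eq0.
have -> (k l : R) : (1 - k) *: u + k *: v - ((1 - l) *: u + l *: v) = (k - l) *: (v - u).
  by apply/rowP => j; rewrite !mxE; ring.
rewrite scaler_eq0 !subr_eq0 [v == u]eq_sym (negbTE uv) orbF => /eqP/invr_inj.
by move=> /eqP; rewrite eqr_nat => /eqP[].
Qed.

(* A nondegenerate segment of the singular locus runs along some singular edge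
   of any triangulation, since it is infinite and there are finitely many. *)
Lemma edge_overlap (F : foam R) u v : u != v ->
  hull [fset u; v]%fset `<=` singular_locus F ->
  exists u1 v1 x (l : R), [/\ singular_edge F u1 v1, open_hull [fset u; v]%fset x,
    open_hull [fset u1; v1]%fset x, l != 0 & v1 - u1 = l *: (v - u)].
Proof.
move=> uv uvS.
pose E := [set e : pt R * pt R | singular_edge F e.1 e.2].
pose I (e : pt R * pt R) := open_hull [fset u; v]%fset `&` hull [fset e.1; e.2]%fset.
have [e [eE infe]] : exists e, E e /\ infinite_set (I e).
  apply: contrapT => nex; apply: (open_hull2_infinite uv).
  apply: (@sub_finite_set _ _ (\bigcup_(e in E) I e)).
    move=> x ox; have [a [b [ab xab]]] := uvS _ (open_hull_sub ox).
    by exists (a, b).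
  apply: bigcup_finite; first exact: finite_singular_edges.
  by move=> e eE; apply: contrapT => infe; apply: nex; exists e.
have e12 := singular_edge_neq eE.
have pick (D : {fset pt R}) : exists2 x, I e x & x \notin D.
  apply: contrapT => nex; apply: infe; apply: sub_finite_set (finite_fset D) => x Ix /=.
  by apply: contrapT => /negP xD; apply: nex; exists x.
(* Avoiding the ends puts [x] in the open edge. As [y] differs from [x], the vector [y - x] is a
   nonzero multiple of both edge vectors, and the quotient of the two factors gives [l]. *)
have [x [ox xe] xN] := pick [fset e.1; e.2]%fset.
have [y [oy ye] yN] := pick [fset e.1; e.2; x]%fset.
have [k k01 xE] := open_hull2P uv ox; have [k' k'01 yE] := open_hull2P uv oy.
have [l l01 xE'] := hull2P e12 xe; have [l' l'01 yE'] := hull2P e12 ye.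
have kk' : k' - k != 0.
  apply: contraNneq yN => /eqP; rewrite subr_eq0 => /eqP kE.
  by rewrite !inE yE kE -xE eqxx orbT.
have ll' : l' - l != 0.
  apply: contraNneq yN => /eqP; rewrite subr_eq0 => /eqP lE.
  by rewrite !inE yE' lE -xE' eqxx orbT.
exists e.1, e.2, x, ((k' - k) / (l' - l)); split=> //.
- rewrite xE'; apply: open_hull2I => //.
  case/andP: l01 => l0 l1; rewrite !lt_neqAle l0 l1 !andbT; apply/andP; split.
    apply: contraNneq xN => l00; rewrite !inE xE' -l00 subr0 scale1r scale0r addr0.
    by rewrite eqxx.
  apply: contraNneq xN => l00; rewrite !inE xE' l00 subrr scale1r scale0r add0r.
  by rewrite eqxx orbT.
- by rewrite mulf_neq0// invr_eq0.
- apply: (scalerI ll'); rewrite scalerA mulrC divfK//.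
  have h : y - x = y - x by [].
  rewrite [in LHS]xE' [in LHS]yE' [in RHS]xE [in RHS]yE in h.
  apply/rowP => j; move/rowP: h => /(_ j); rewrite !mxE => h.
  have {h} : (l' - l) * (e.2 0 j - e.1 0 j) - (k' - k) * (v 0 j - u 0 j) = 0.
    by move/eqP: h; rewrite -subr_eq0 => /eqP <-; ring.
  by move/eqP; rewrite subr_eq0 => /eqP.
Qed.

(** From [x], interior to both edges, move slightly towards the third vertex [a] of [t]. The point
    reached is covered by a triangle of [T'] that contains [x], hence has the edge from [u1] to
    [v1]. The number [r > 0] says that [a1] and [a] lie on the same side of the common line. *)
Lemma local_triangle (F F' : foam R) (T T' : {fset otri R}) (K : set (pt R))
    t u v a u1 v1 x (l : R) :
  (T `<=` triangles F)%fset -> (T' `<=` triangles F')%fset ->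
  closed K -> carrier T `\` K `<=` carrier T' ->
  singular_locus F = singular_locus F' ->
  t \in T -> verts t = [fset u; v; a]%fset -> u != v -> ~ K x ->
  open_hull [fset u; v]%fset x ->
  singular_edge F' u1 v1 -> open_hull [fset u1; v1]%fset x ->
  v1 - u1 = l *: (v - u) ->
  exists t1, [/\ t1 \in T', ([fset u1; v1] `<=` verts t1)%fset,
    forall a1, verts t1 = [fset u1; v1; a1]%fset ->
      exists r q, 0 < r /\ a1 - u1 = r *: (a - u) + q *: (v - u)
    & exists y, open_hull (verts t) y /\ open_hull (verts t1) y].
Proof.
move=> /fsubsetP TF /fsubsetP TF' clK TT' SS' tT tE uv xK xuv uv1 xuv1 lE.
have uv1N := singular_edge_neq uv1.
have c3 : #|` [fset u; v; a]%fset| = 3%N.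
  by rewrite -tE; apply/card_verts/(foam_nondegenerate (foamP F))/TF.
(* [B] is the union of the triangles of [T'] that miss [x]; near [x] one avoids both [B] and [K]. *)
pose B := \bigcup_(s in [set` [fset s in T' | `[< ~ hull (verts s) x >]]%fset])
  hull (verts s).
have clB : closed B.
  by apply: closed_bigcup => [|s _]; [exact: finite_fset|exact: hull_closed].
have nx : nbhs x (~` (K `|` B)).
  apply: open_nbhs_nbhs; split; first by rewrite openC; exact: closedU.
  by move=> [//|[s /=]]; rewrite !inE => /andP[_ /asboolP].
have [e /andP[e0 e1] he] := near_seg a nx.
have [k /andP[k0 k1] xE] := open_hull2P uv xuv.
have seg (d : R) : 0 < d <= e -> open_hull (verts t) ((1 - d) *: x + d *: a).
  move=> /andP[d0 de]; have d1 := le_lt_trans de e1.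
  have -> : (1 - d) *: x + d *: a =
      (1 - (1 - d) * k - d) *: u + ((1 - d) * k) *: v + d *: a.
    by apply/rowP => j; rewrite xE !mxE; ring.
  rewrite tE; apply: open_hull3I => //; last by apply: mulr_gt0; rewrite ?subr_gt0.
  have -> : 1 - (1 - d) * k - d = (1 - d) * (1 - k) by ring.
  by apply: mulr_gt0; rewrite subr_gt0.
pose y := (1 - e) *: x + e *: a.
have oy : open_hull (verts t) y by apply: seg; rewrite e0 lexx.
have [yK yB] : ~ K y /\ ~ B y.
  by have := he e; rewrite e0 lexx => /(_ isT) nKB; split=> h; apply: nKB; [left|right].
have [t1 /= t1T' yt1] : carrier T' y.
  by apply: TT'; split=> //; exists t => //; exact: open_hull_sub.
have xt1 : hull (verts t1) x.
  by apply: contrapT => nxt1; apply: yB; exists t1 => //=; rewrite !inE t1T'; apply/asboolP.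
have t1F := TF' _ t1T'.
have [s sF' uvs] := singular_edge_verts uv1.
have uvt1 := open_hull_complex (foamP F') sF' t1F uvs (fsubset_refl _) xuv1 xt1.
have [a1 a1E] : exists a1, verts t1 = [fset u1; v1; a1]%fset.
  have := dedgesP uv1N (fsubsetP uvt1 u1 _) (fsubsetP uvt1 v1 _).
  rewrite !inE !eqxx ?orbT => /(_ isT isT)[] /dedges_rot[w /rot_verts ->]; exists w => //.
  by rewrite (fsetUC [fset v1]%fset).
have c31 : #|` [fset u1; v1; a1]%fset| = 3%N.
  by rewrite -a1E; exact/card_verts/(foam_nondegenerate (foamP F')).
rewrite a1E in yt1; have [b [c [abc0 b0 c0 yE]]] := hull3P c31 yt1.
(* A zero weight at [a1] would put [y] on the singular edge, but [y] is interior to [t]. *)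
have cp : 0 < c.
  rewrite lt_neqAle c0 andbT eq_sym; apply/negP => /eqP cz.
  have [] := open_hull_singular (foamP F) (TF _ tT) oy.
  rewrite SS'; exists u1, v1; split=> //; rewrite yE cz subr0 scale0r addr0.
  by apply: hull2I => //; rewrite b0; move: abc0; rewrite cz subr0 subr_ge0.
have [m /andP[m0 m1] xE1] := open_hull2P uv1N xuv1.
exists t1; split=> //.
- move=> a2 a2E; have <- : a1 = a2.
    have : a1 \in [fset u1; v1; a2]%fset by rewrite -a2E a1E !inE eqxx orbT.
    rewrite !inE => /orP[/orP[]|] /eqP // h; move: c31; rewrite h.
      by rewrite fsetUC fsetUA fsetUid cardfs2; case: (_ == _).
    by rewrite -fsetUA fsetUid cardfs2; case: (_ == _).
  (* Both factors come from equating two forms of [y - x]: it is [e] times [a - x] in [t], and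
     [(b - m) *: (v1 - u1) + c *: (a1 - u1)] in [t1]. *)
  exists (e / c), (((m - b) * l - e * k) / c); split; first exact: divr_gt0.
  have cN : c != 0 by rewrite gt_eqF.
  apply: (scalerI cN); rewrite [RHS]scalerDr !scalerA.
  rewrite (mulrC c (e / c)) (mulrC c (_ / c)) !divfK//.
  apply/rowP => j.
  move/rowP: xE => /(_ j); move/rowP: xE1 => /(_ j); move/rowP: lE => /(_ j).
  move/rowP: yE => /(_ j); rewrite /y !mxE.
  set X := x 0 j; set A := a 0 j; set U := u 0 j; set V := v 0 j.
  set U1 := u1 0 j; set V1 := v1 0 j; set A1 := a1 0 j => e_1 e_2 e_3 e_4.
  have -> : c * (A1 - U1) = (1 - e) * X + e * A - U1 - b * (V1 - U1).
    by rewrite e_1; ring.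
  have -> : (1 - e) * X + e * A - U1 = (X - U1) + e * (A - X) by ring.
  rewrite {2}e_4 {1}e_3.
  have -> : (1 - m) * U1 + m * V1 - U1 = m * (V1 - U1) by ring.
  by rewrite e_2; ring.
(* [y] may lie on the boundary of [t1]; its midpoint with [x], which is interior to the edge, has
   positive weights at all three vertices. *)
exists ((1 - e / 2) *: x + (e / 2) *: a); split.
  by apply: seg; apply/andP; split; lra.
rewrite a1E.
have -> : (1 - e / 2) *: x + (e / 2) *: a =
    (1 - (m + b) / 2 - c / 2) *: u1 + ((m + b) / 2) *: v1 + (c / 2) *: a1.
  apply/rowP => j; move/rowP: xE1 => /(_ j); move/rowP: yE => /(_ j).
  rewrite /y !mxE => e_1 e_2.
  have -> : (1 - e / 2) * x 0 j + e / 2 * a 0 j =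
      (x 0 j + ((1 - e) * x 0 j + e * a 0 j)) / 2 by field.
  by rewrite e_1 {1}e_2; field.
by apply: open_hull3I => //; lra.
Qed.

Lemma det_scale_last (e1 e2 w : pt R) (l : R) :
  \det (\matrix_(i < 3) [tuple e1; e2; - (l *: w)]`_i) =
  l * \det (\matrix_(i < 3) [tuple e1; e2; - w]`_i).
Proof.
rewrite (@determinant_multilinear _ _ _ (\matrix_(i < 3) [tuple e1; e2; - w]`_i)
  (\matrix_(i < 3) [tuple e1; e2; - w]`_i) ord_max l 0).
- by rewrite mul0r addr0.
- by apply/rowP => j; rewrite !mxE/= mul0r addr0 mulrN.
- by apply/matrixP => i j; rewrite !mxE; case: i => -[|[|]].
- by apply/matrixP => i j; rewrite !mxE; case: i => -[|[|]].
Qed.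

(** A positive multiple of a vector plus a multiple of [t] spans with [t] the same half-plane, so
    the frame [e1], [e2] and the angles can be kept; [l > 0] preserves the direction of sight. *)
Lemma counterclockwise_scale (t d a b d' a' b' : pt R) (l rd ra rb qd qa qb : R) :
  0 < l -> 0 < rd -> 0 < ra -> 0 < rb ->
  d' = rd *: d + qd *: t -> a' = ra *: a + qa *: t -> b' = rb *: b + qb *: t ->
  counterclockwise t d a b -> counterclockwise (l *: t) d' a' b'.
Proof.
move=> l0 rd0 ra0 rb0 d'E a'E b'E [e1 [e2 [[n1 n2 o12 o1 o2] [dt]]]].
move=> [al [be [alp [be2 [rayd raya rayb]]]]].
exists e1, e2; split.
  by split=> //; rewrite linearZ/= -scalemxAr ?o1 ?o2 scaler0.
split; first by rewrite det_scale_last mulr_gt0.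
have ray (p p' : pt R) (r q phi : R) : 0 < r -> p' = r *: p + q *: t ->
    (exists r q, 0 < r /\ p = r *: (cos phi *: e1 + sin phi *: e2) + q *: t) ->
    exists r q, 0 < r /\ p' = r *: (cos phi *: e1 + sin phi *: e2) + q *: (l *: t).
  move=> r0 -> [r' [q' [r'0 ->]]]; exists (r * r'), ((r * q' + q) / l).
  split; first exact: mulr_gt0.
  by rewrite !scalerA divfK ?gt_eqF// scalerDr !scalerA scalerDl addrA.
exists al, be; split=> //; split=> //; split.
- exact: ray rd0 d'E rayd.
- exact: ray ra0 a'E raya.
- exact: ray rb0 b'E rayb.
Qed.

Lemma same_orientation_sym t t' :
  same_orientation t t' -> same_orientation t' t.
Proof.
move=> [M ME M0]; have uM : M \in unitmx by rewrite unitmxE unitfE gt_eqF.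
exists (invmx M); last by rewrite det_inv invr_gt0.
by rewrite ME mulmxA mulVmx// mul1mx.
Qed.

(** The edge and the three triangles witnessing positivity are replaced by those of [F'] in the same
    half-planes. The neck enters only as a closed set [K] off the singular locus, so the lemma
    serves for both directions between a foam and its cut. *)
Lemma positive_transfer (F F' : foam R) (c : precoloring F) (c' : precoloring F')
    (K Z : set (pt R)) :
  closed K -> (forall x, singular_locus F x -> ~ K x) ->
  singular_locus F = singular_locus F' ->
  carrier (thin F) = carrier (thin F') ->
  carrier (double F) `\` K `<=` carrier (double F') ->
  (forall t t1 x, t \in thin F -> t1 \in thin F' ->
    open_hull (verts t) x -> open_hull (verts t1) x -> same_orientation t t1) ->
  (forall (C : fset_set (thin_facets F)) (C' : fset_set (thin_facets F')),
    val C = val C' -> c C = c' C') ->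
  singular_circles F Z -> positive c Z -> positive c' Z.
Proof.
move=> clK KS SS' TT DD or cc' [z Sz ZE].
move=> [u [v [d [a [b [td [ta [tb [[uvS uvZ]]]]]]]]]].
move=> [tdD taT tbT] [rd ra rb] ccw [C cC taC].
have uvN := singular_edge_neq uvS.
have [|u1 [v1 [x [l [uv1 xuv xuv1 l0 lE]]]]] := @edge_overlap F' u v uvN.
  by rewrite -SS' => y yuv; exists u, v.
have uv1N := singular_edge_neq uv1.
have Sx : singular_locus F x by exists u, v; split=> //; exact: open_hull_sub.
have xK := KS _ Sx.
have TK : carrier (thin F) `\` K `<=` carrier (thin F') by rewrite -TT => y [].
have sT (G : foam R) : (thin G `<=` triangles G)%fset by exact/fsubsetP/thin_sub.
have sD (G : foam R) : (double G `<=` triangles G)%fset by exact/fsubsetP/double_sub.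
have [n1 n2 n3 n4] := uv1.
have mem2 t1 : ([fset u1; v1] `<=` verts t1)%fset -> u1 \in verts t1 /\ v1 \in verts t1.
  by move=> /fsubsetP s1; split; apply: s1; rewrite !inE eqxx ?orbT.
have thin_dir t1 : t1 \in thin F' -> ([fset u1; v1] `<=` verts t1)%fset ->
    exists w, rot_of t1 u1 v1 w.
  move=> t1T /mem2[ut1 vt1].
  have [/dedges_rot//|vu] := dedgesP uv1N ut1 vt1.
  by have := num_along_gt0 t1T vu; rewrite n2.
have double_dir t1 : t1 \in double F' -> ([fset u1; v1] `<=` verts t1)%fset ->
    exists w, rot_of t1 v1 u1 w.
  move=> t1T /mem2[ut1 vt1].
  have [vu|/dedges_rot//] := dedgesP uv1N ut1 vt1.
  by have := num_along_gt0 t1T vu; rewrite n3.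
have thin_corr t w : t \in thin F -> rot_of t u v w -> exists t1 w1 r q,
    [/\ t1 \in thin F', rot_of t1 u1 v1 w1, 0 < r,
      w1 - u1 = r *: (w - u) + q *: (v - u)
      & exists y, open_hull (verts t) y /\ open_hull (verts t1) y].
  move=> tT rt.
  have [t1 [t1T st1 t1E oy]] := local_triangle (sT F) (sT F') clK TK SS' tT
    (rot_verts rt) uvN xK xuv uv1 xuv1 lE.
  have [w1 rt1] := thin_dir _ t1T st1.
  have [r [q [r0 rq]]] := t1E _ (rot_verts rt1).
  by exists t1, w1, r, q.
have [ta1 [a1 [r_a [q_a [ta1T ra1 r_a0 a1E [y [yta yta1]]]]]]] := thin_corr ta a taT ra.
have [tb1 [b1 [r_b [q_b [tb1T rb1 r_b0 b1E _]]]]] := thin_corr tb b tbT rb.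
have tdE : verts td = [fset u; v; d]%fset by rewrite (rot_verts rd) (fsetUC [fset v]%fset).
have [td1 [td1D std1 td1E _]] := local_triangle (sD F) (sD F') clK DD SS' tdD
    tdE uvN xK xuv uv1 xuv1 lE.
have [d1 rd1] := double_dir _ td1D std1.
have [r_d [q_d [r_d0 d1E]]] : exists r q, 0 < r /\ d1 - u1 = r *: (d - u) + q *: (v - u).
  by apply: td1E; rewrite (rot_verts rd1) (fsetUC [fset v1]%fset).
(* The frames of the two thin triangles differ by a matrix of determinant [l * r_a]; their
   orientations agree and [r_a > 0], hence [l > 0]. *)
have lp : 0 < l.
  have [M ME M0] := or _ _ _ taT ta1T yta yta1.
  have [N1 N1E dN1] := rot_frame_sym ra; have [N2 N2E dN2] := rot_frame ra1.
  have DE : frame (u1, v1, a1) = mx2 l 0 q_a r_a *m frame (u, v, a).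
    apply: mx2_frame; first by rewrite scale0r addr0.
    by rewrite a1E addrC.
  have fr : row_free (frame (u, v, a)).
    exact/(rot_free ra)/(foam_nondegenerate (foamP F))/thin_sub.
  have : N1 *m M *m N2 *m mx2 l 0 q_a r_a = 1%:M.
    apply: (row_free_inj fr); rewrite mul1mx.
    by rewrite -!mulmxA -DE -N2E -ME -N1E.
  move=> /(congr1 determinant); rewrite !det_mulmx det1 dN1 dN2 det_mx2.
  rewrite mul1r mulr1 mul0r subr0 => e1.
  have : 0 < \det M * (l * r_a) by rewrite e1.
  by rewrite pmulr_rgt0// pmulr_lgt0.
exists u1, v1, d1, a1, b1, td1, ta1, tb1; split.
- split=> //; rewrite -ZE.
  have Zx : Z x by apply: uvZ; exact: open_hull_sub.
  rewrite -ZE in Zx; rewrite (same_connected_component Zx).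
  apply: connected_component_max; first exact: open_hull_sub.
    by rewrite SS' => p puv; exists u1, v1.
  exact/convexs_connected/hull_convexs.
- by [].
- by [].
- rewrite lE; exact: counterclockwise_scale lp r_d0 r_a0 r_b0 d1E a1E b1E ccw.
- have [C1 tC1] := thin_triangle_facet ta1T.
  have oC1 := subset_trans (open_hull_off_singular (thin_sub ta1T)) tC1.
  apply/(tri_colorP c' _ oC1); rewrite -cC; apply: cc'.
  have CT : thin_facets F' (val C).
    by rewrite thin_facetsE -SS' -TT -thin_facetsE; exact: thin_facet_val.
  apply: (components_eq (x := y) (proj1 CT) (proj1 (thin_facet_val C1))).
    exact: taC.
  exact: oC1.
Qed.

End Transfer.

(** * The Euler characteristic as a measure *)

Section EulerMeasure.
Context (R : realType).
Implicit Types (x y : pt R) (A B Q : set (pt R)) (f g : pt R -> int) (m n : int).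

Definition indi A x : int := (`[< A x >])%:R.
(** For a compact convex set this is its Euler characteristic. *)
Definition inhab A : int := (`[< A !=set0 >])%:R.
Definition cconv A := compact A /\ convexs A.

Lemma cconvI A B : cconv A -> cconv B -> cconv (A `&` B).
Proof.
move=> [cA vA] [cB vB]; split.
  by apply: compact_closedI => //; exact: compact_closed_pt.
by move=> x y k [Ax Bx] [Ay By] k01; split; [exact: vA|exact: vB].
Qed.

Lemma cconv_hull s : cconv (hull s : set (pt R)).
Proof. by split; [exact: hull_compact|exact: hull_convexs]. Qed.

Lemma cconv_slice A j (r : R) : cconv A -> cconv (A `&` [set x | x 0 j = r]).
Proof.
move=> [cA vA]; split.
  apply: (compact_closedI cA).
  apply: (@preimage_closed _ _ (fun x : pt R => x 0 j) [set s | s = r]).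
    by move=> x _; exact: (@coord_continuous R 1 3 0 j x).
  exact: closed_eq.
move=> x y k [Ax xr] [Ay yr] k01; split; first exact: vA.
by rewrite /= !mxE xr yr; ring.
Qed.

Lemma right_gap (s : seq R) (b : R) :
  exists2 c, b < c & forall e, e \in s -> e <= b \/ c < e.
Proof.
elim: s => [|e s [c bc IH]]; first by exists (b + 1) => //; rewrite ltrDl.
have [eb|be] := leP e b.
  by exists c => // d; rewrite inE => /predU1P[->|/IH//]; left.
exists (Num.min c ((b + e) / 2)).
  by rewrite lt_min bc/=; lra.
move=> d; rewrite inE => /predU1P[->|/IH[db|cd]]; [right|by left|right].
  by rewrite gt_min; apply/orP; right; lra.
by rewrite gt_min cd.
Qed.

(* The value at [b] minus the value just after [b] counts the intervals whose
   right end is [b]. *)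
Lemma interval_relation (I : eqType) (r : seq I) (P : pred I) (n : I -> int)
    (lo hi : I -> R) :
  (forall i, P i -> lo i <= hi i) ->
  (forall t, \sum_(i <- r | P i) n i * (lo i <= t <= hi i)%R%:R = 0) ->
  \sum_(i <- r | P i) n i = 0.
Proof.
move=> lohi rel; pose hs := undup (map hi r).
have -> : \sum_(i <- r | P i) n i =
    \sum_(b <- hs) \sum_(i <- r | P i) n i * (hi i == b)%:R.
  rewrite exchange_big/= big_seq_cond [RHS]big_seq_cond.
  apply: eq_bigr => i /andP[ir _].
  rewrite (bigD1_seq (hi i)) ?undup_uniq//=; last by rewrite mem_undup map_f.
  rewrite eqxx mulr1 big1 ?addr0// => b; rewrite eq_sym => /negbTE ->.
  by rewrite mulr0.
apply: big1 => b _; have [c bc cP] := right_gap (map lo r ++ map hi r) b.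
rewrite -[LHS](_ : \sum_(i <- r | P i) n i * (lo i <= b <= hi i)%R%:R -
    \sum_(i <- r | P i) n i * (lo i <= c <= hi i)%R%:R = _); first by rewrite !rel subrr.
rewrite -sumrB big_seq_cond [RHS]big_seq_cond; apply: eq_bigr => i /andP[ir Pi].
rewrite -mulrBr; congr (_ * _); have le := lohi _ Pi.
have [lb|cl] := cP (lo i) (ltac:(by rewrite mem_cat map_f)).
  have [hb|ch] := cP (hi i) (ltac:(by rewrite mem_cat orbC map_f)).
    rewrite lb (le_trans lb (ltW bc))/= [c <= _]leNgt (le_lt_trans hb bc) subr0.
    by rewrite eq_le hb.
  rewrite lb (le_trans lb (ltW bc))/= (ltW ch) (ltW (lt_trans bc ch)) subrr.
  by rewrite gt_eqF// (lt_trans bc).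
rewrite [lo i <= b]leNgt (lt_trans bc cl) [lo i <= c]leNgt cl subrr.
by rewrite gt_eqF// (lt_le_trans (lt_trans bc cl)).
Qed.

(** Compactness gives points with extreme coordinate, and convexity fills in the values between
    them. *)
Lemma coord_range A (j : 'I_3) : cconv A -> A !=set0 ->
  exists lh : R * R, lh.1 <= lh.2 /\
    forall t, (A `&` [set x | x 0 j = t]) !=set0 <-> lh.1 <= t <= lh.2.
Proof.
move=> [cA vA] A0; have cj : {within A, continuous (fun x : pt R => x 0 j)}.
  by apply: continuous_subspaceT; exact: (@coord_continuous R 1 3 0 j).
have [a [Aa amin]] : exists a : pt R, A a /\ forall x, A x -> a 0 j <= x 0 j.
  have [a /set_mem Aa amin] := compact_EVT_min A0 cA cj.
  by exists a; split=> // x Ax; exact/amin/mem_set.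
have [b [Ab bmax]] : exists b : pt R, A b /\ forall x, A x -> x 0 j <= b 0 j.
  have [b /set_mem Ab bmax] := compact_EVT_max A0 cA cj.
  by exists b; split=> // x Ax; exact/bmax/mem_set.
exists (a 0 j, b 0 j) => /=; split; first exact: amin.
move=> t; split=> [[x [Ax <-]]|/andP[at_ tb]].
  by rewrite amin ?bmax.
have [ab|ab] := eqVneq (a 0 j) (b 0 j).
  by exists a; split=> //=; apply/le_anti; rewrite at_ ab tb.
have ab0 : 0 < b 0 j - a 0 j.
  by rewrite subr_gt0 lt_neqAle ab (le_trans at_ tb).
have [k k01 kE] : exists2 k : R, 0 <= k <= 1 & k * a 0 j + (1 - k) * b 0 j = t.
  exists ((b 0 j - t) / (b 0 j - a 0 j)); last by field; rewrite gt_eqF.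
  rewrite divr_ge0 ?(ltW ab0) ?subr_ge0//=.
  by rewrite ler_pdivrMr// mul1r lerD2l lerN2.
by exists (k *: a + (1 - k) *: b); split; [exact: vA|rewrite /= !mxE].
Qed.

Lemma coord_ranges (j : 'I_3) : exists lh : set (pt R) -> R * R,
  forall A, cconv A -> A !=set0 -> (lh A).1 <= (lh A).2 /\
    forall t, (A `&` [set x | x 0 j = t]) !=set0 <-> (lh A).1 <= t <= (lh A).2.
Proof.
have [A|lh lhP] := @choice _ _ (fun A (lh : R * R) => cconv A -> A !=set0 ->
  lh.1 <= lh.2 /\ forall t, (A `&` [set x | x 0 j = t]) !=set0 <-> lh.1 <= t <= lh.2).
  have [[cA A0]|nA] := pselect (cconv A /\ A !=set0).
    by have [lh] := coord_range j cA A0; exists lh.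
  by exists (0, 0) => cA A0; case: nA.
by exists lh.
Qed.

(* Induction on the number [k] of coordinates that vary: slicing along the last
   one reduces a relation to a relation between intervals. *)
Lemma euler_relation_coord k (l : seq (int * set (pt R))) (c : pt R) :
  (forall q, q \in l -> cconv q.2 /\
    forall x, q.2 x -> forall j : 'I_3, (k <= j)%N -> x 0 j = c 0 j) ->
  (forall x, \sum_(q <- l) q.1 * indi q.2 x = 0) ->
  \sum_(q <- l) q.1 * inhab q.2 = 0.
Proof.
elim: k l c => [|k IH] l c lP rel.
  (* With every coordinate fixed, a set of the list is empty or the singleton of [c], so [inhab] is
     the value of its indicator at [c]. *)
  rewrite -[RHS](rel c) !big_seq; apply: eq_bigr => q ql; congr (_ * (nat_of_bool _)%:R).
  have [_ qc] := lP _ ql; apply: asbool_equiv_eq; split=> [[x qx]|]; last by exists c.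
  suff <- : x = c by [].
  by apply/rowP => j; exact: qc.
have [k3|k3] := ltnP k 3; last first.
  apply: (IH l c) => // q ql; have [cq _] := lP _ ql; split=> // x _ j kj.
  by have := leq_trans k3 kj; rewrite leqNgt ltn_ord.
pose j0 := Ordinal k3; have [lh lhP] := coord_ranges j0.
pose P (q : int * set (pt R)) := `[< cconv q.2 /\ q.2 !=set0 >].
have -> : \sum_(q <- l) q.1 * inhab q.2 = \sum_(q <- l | P q) q.1.
  rewrite [RHS]big_mkcond/= !big_seq; apply: eq_bigr => q ql.
  have [cq _] := lP _ ql; rewrite /P /inhab asbool_and; have -> : `[< cconv q.2 >] by apply/asboolP.
  by case: asboolP => _ /=; rewrite ?mulr1 ?mulr0.
apply: (interval_relation (lo := fun q => (lh q.2).1) (hi := fun q => (lh q.2).2)).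
  by move=> q /asboolP[cq q0]; have [] := lhP _ cq q0.
move=> t; pose H := [set x : pt R | x 0 j0 = t].
(* The interval relation at height [t] is the relation between the slices by [H], on which
   coordinate [k] is constant as well. *)
have <- : \sum_(q <- [seq (q.1, q.2 `&` H) | q <- l]) q.1 * inhab q.2 =
    \sum_(q <- l | P q) q.1 * ((lh q.2).1 <= t <= (lh q.2).2)%R%:R.
  rewrite big_map [RHS]big_mkcond/= !big_seq; apply: eq_bigr => q ql /=.
  have [cq _] := lP _ ql; rewrite /P /inhab.
  have [q0|nq] := pselect (q.2 !=set0).
    rewrite (asboolT (conj cq q0)).
    have [_ lhE] := lhP _ cq q0; congr (_ * (nat_of_bool _)%:R).
    by apply/asboolP/idP => /lhE.
  rewrite (@asboolF (cconv q.2 /\ q.2 !=set0)); last by case.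
  by rewrite asboolF ?mulr0// => -[x [qx _]]; apply: nq; exists x.
apply: (IH _ (\row_j if j == j0 then t else c 0 j)).
  move=> _ /mapP[q ql ->] /=; have [cq qc] := lP _ ql; split; first exact: cconv_slice.
  move=> x [qx xt] j kj; rewrite mxE; case: eqP => [->//|/eqP jj0].
  apply: qc => //; rewrite ltn_neqAle kj andbT; apply: contraNneq jj0 => kjE.
  exact/eqP/val_inj.
move=> x; rewrite big_map/=; have [xt|xt] := pselect (H x).
  rewrite -[RHS](rel x); apply: eq_bigr => q _; congr (_ * (nat_of_bool _)%:R).
  by apply: asbool_equiv_eq; split=> [[]|].
by apply: big1 => q _; rewrite /indi (_ : `[< _ >] = false) ?mulr0//; apply/asboolP => -[].
Qed.

Lemma euler_relation (l : seq (int * set (pt R))) :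
  (forall q, q \in l -> cconv q.2) ->
  (forall x, \sum_(q <- l) q.1 * indi q.2 x = 0) ->
  \sum_(q <- l) q.1 * inhab q.2 = 0.
Proof.
move=> lc rel; apply: (@euler_relation_coord 3 l 0) => // q ql.
by split=> [|x _ j]; [exact: lc|rewrite leqNgt ltn_ord].
Qed.

(* [f] is an integral combination of indicators of compact convex sets of the
   class [D]; [n] is its integral against the Euler characteristic. *)
Definition has_euler (D : set (pt R) -> Prop) f n :=
  exists l : seq (int * set (pt R)), [/\ forall q, q \in l -> cconv q.2 /\ D q.2,
    forall x, f x = \sum_(q <- l) q.1 * indi q.2 x
    & n = \sum_(q <- l) q.1 * inhab q.2].

(** The difference of two representations of [f] is a linear relation between compact convex
    sets. *)
Lemma has_euler_uniq D f m n : has_euler D f m -> has_euler D f n -> m = n.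
Proof.
move=> [l [lc fl ->]] [l' [l'c fl' ->]].
apply/eqP; rewrite -subr_eq0; apply/eqP.
have := @euler_relation (l ++ [seq (- q.1, q.2) | q <- l']).
rewrite !big_cat big_map /=.
under [X in _ + X]eq_bigr do rewrite mulNr.
rewrite sumrN; apply.
  move=> q; rewrite mem_cat => /orP[/lc[]//|/mapP[q' /l'c[? _] ->]//].
move=> x; rewrite big_cat big_map /=.
under [X in _ + X]eq_bigr do rewrite mulNr.
by rewrite sumrN -fl -fl' subrr.
Qed.

Lemma has_euler_ext D f g n : f =1 g -> has_euler D f n -> has_euler D g n.
Proof. by move=> fg [l [lc fl ->]]; exists l; split=> // x; rewrite -fg. Qed.

Lemma has_euler0 D : has_euler D (fun=> 0) 0.
Proof. by exists [::]; split=> // [x|]; rewrite big_nil. Qed.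

Lemma has_eulerD D f g m n : has_euler D f m -> has_euler D g n ->
  has_euler D (fun x => f x + g x) (m + n).
Proof.
move=> [l [lc fl ->]] [l' [l'c fl' ->]]; exists (l ++ l'); split.
- by move=> q; rewrite mem_cat => /orP[/lc|/l'c].
- by move=> x; rewrite big_cat/= -fl -fl'.
- by rewrite big_cat.
Qed.

Lemma has_eulerN D f m : has_euler D f m -> has_euler D (fun x => - f x) (- m).
Proof.
move=> [l [lc fl ->]]; exists [seq (- q.1, q.2) | q <- l]; split.
- by move=> _ /mapP[q /lc ? ->].
- by move=> x; rewrite fl big_map -sumrN; apply: eq_bigr => q _; rewrite mulNr.
- by rewrite big_map -sumrN; apply: eq_bigr => q _; rewrite mulNr.
Qed.

Lemma has_eulerB D f g m n : has_euler D f m -> has_euler D g n ->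
  has_euler D (fun x => f x - g x) (m - n).
Proof. by move=> ef eg; apply: has_eulerD => //; exact: has_eulerN. Qed.

Lemma has_euler_sum D (I : eqType) (r : seq I) (P : pred I) (f : I -> pt R -> int)
    (m : I -> int) : (forall i, i \in r -> P i -> has_euler D (f i) (m i)) ->
  has_euler D (fun x => \sum_(i <- r | P i) f i x) (\sum_(i <- r | P i) m i).
Proof.
elim: r => [|i r IH] h.
  by rewrite big_nil; apply: has_euler_ext (has_euler0 D) => x; rewrite big_nil.
have {}IH := IH (fun j jr => h j (mem_behead (jr : j \in behead (i :: r)))).
rewrite big_cons; case: ifP => Pi; last first.
  by apply: has_euler_ext IH => x; rewrite big_cons Pi.
have hi := h i (mem_head _ _) Pi.
by apply: has_euler_ext (has_eulerD hi IH) => x; rewrite big_cons Pi.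
Qed.

Lemma has_euler_cconv (D : set (pt R) -> Prop) Q :
  cconv Q -> D Q -> has_euler D (indi Q) (inhab Q).
Proof.
move=> cQ DQ; exists [:: (1, Q)]; split; first by move=> q; rewrite inE => /eqP ->.
  by move=> x; rewrite big_seq1 mul1r.
by rewrite big_seq1 mul1r.
Qed.

Lemma inhab1 Q x : Q x -> inhab Q = 1.
Proof. by move=> Qx; rewrite /inhab (_ : `[< _ >])//; apply/asboolP; exists x. Qed.

End EulerMeasure.

(** * Euler characteristics of foams *)

Section EulerFoams.
Context (R : realType).
Implicit Types (x y : pt R) (s r : {fset pt R}) (A Q X : set (pt R)) (m n : int).

Let anyset : set (pt R) -> Prop := fun=> True.

(** Adding or removing a fixed element [p] is a sign-reversing involution of the subsets of [s]. *)
Lemma sum_signs_eq0 s : s != fset0 ->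
  \sum_(r <- fpowerset s) (-1 : int) ^+ #|` r| = 0.
Proof.
move=> /fset0Pn[p ps].
pose g r := if p \in r then (r `\ p)%fset else (p |` r)%fset.
have gK : involutive g.
  move=> r; rewrite /g; have [pr|pr] := boolP (p \in r).
    by rewrite !inE eqxx/= fsetD1K.
  by rewrite !inE eqxx/= fsetU1K.
have gs r : (g r `<=` s)%fset = (r `<=` s)%fset.
  rewrite /g; case: ifP => pr; last by rewrite fsubUset fsub1set ps.
  apply/idP/idP => [|rs]; last exact: fsubset_trans (fsubD1set _ _) rs.
  by rewrite -{2}(fsetD1K pr) fsubUset fsub1set ps.
have perm : perm_eq [seq g r | r <- fpowerset s] (fpowerset s).
  apply: uniq_perm; rewrite ?(map_inj_uniq (inv_inj gK)) ?fset_uniq//.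
  move=> r; rewrite fpowersetE; apply/mapP/idP => [[r' + ->]|rs].
    by rewrite fpowersetE gs.
  by exists (g r); rewrite ?gK// fpowersetE gs.
have neg : \sum_(r <- fpowerset s) (-1 : int) ^+ #|` r| =
    - \sum_(r <- fpowerset s) (-1 : int) ^+ #|` r|.
  rewrite -{1}(perm_big _ perm) big_map -sumrN; apply: eq_bigr => r _.
  rewrite /g; case: ifP => pr; last by rewrite cardfsU1 pr exprS mulN1r.
  by rewrite [in RHS](cardfsD1 p) pr exprS mulN1r opprK.
by move/eqP: neg; rewrite -addr_eq0 -mulr2n mulrn_eq0/= => /eqP.
Qed.

Lemma hull_support s x : hull s x ->
  exists r, [/\ (r `<=` s)%fset, r != fset0 & open_hull r x].
Proof.
move=> [a [a0 a1 xa]]; pose r := [fset p in s | 0 < a p]%fset.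
have rs : (r `<=` s)%fset by apply/fsubsetP => p; rewrite !inE => /andP[].
have ar p : p \in s -> p \notin r -> a p = 0.
  move=> ps; rewrite !inE ps/= => ap.
  by apply/le_anti; rewrite a0// andbT leNgt.
have rsum (V : nmodType) (f : pt R -> V) : (forall p, a p = 0 -> f p = 0) ->
    \sum_(p <- s) f p = \sum_(p <- r) f p.
  move=> f0; apply/esym; apply: big_fset_incl => // p ps pr.
  exact/f0/ar.
exists r; split=> //.
- apply/eqP => r0; move: a1; rewrite (rsum _ a)// r0 big_seq_fset0 => /eqP.
  by rewrite eq_sym oner_eq0.
- exists a; split.
  + by move=> p; rewrite !inE => /andP[].
  + by rewrite -rsum.
  + by rewrite -rsum// => p ->; rewrite scale0r.
Qed.

Lemma sum_indi_disjoint (I : eqType) (r : seq I) (P : pred I)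
    (B : I -> set (pt R)) (A : set (pt R)) x : uniq r ->
  (forall i j, i \in r -> j \in r -> B i x -> B j x -> i = j) ->
  A x <-> (exists i, [/\ i \in r, P i & B i x]) ->
  indi A x = \sum_(i <- r | P i) indi (B i) x.
Proof.
move=> ur uniB AB; rewrite /indi; have [Ax|nA] := pselect (A x).
  have [i [ir Pi Bi]] := proj1 AB Ax.
  rewrite asboolT// big_mkcond/= (bigD1_seq i)//= Pi asboolT// big_seq_cond big1 ?addr0//.
  move=> j /andP[jr ji]; case: ifP => // _; rewrite asboolF// => Bj.
  by move/eqP: ji; apply; exact: uniB.
rewrite asboolF// big_seq_cond big1// => i /andP[ir Pi].
by rewrite asboolF// => Bi; apply: nA; apply/AB; exists i.
Qed.

Lemma signS (s : {fset pt R}) : s != fset0 ->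
  (-1 : int) ^+ #|` s|.-1 = - (-1) ^+ #|` s|.
Proof. by rewrite -cardfs_gt0; case: #|` s| => // k _; rewrite exprS mulN1r opprK. Qed.

(** A closed simplex is the disjoint union of its open faces, so the indicator of the open simplex
    is that of the hull, of integral 1, minus those of its proper open faces, known by induction.
    The result is minus one to the dimension. *)
Lemma has_euler_open_hull t s : row_free (frame t) -> (s `<=` verts t)%fset ->
  s != fset0 -> has_euler anyset (indi (open_hull s)) ((-1) ^+ #|` s|.-1).
Proof.
move=> free; have [k] := ubnP #|` s|; elim: k s => // k IH s sk st s0.
pose P r := (r != fset0) && (r != s).
have sumE f : \sum_(r <- fpowerset s) f r =
    f s + (f fset0 + \sum_(r <- fpowerset s | P r) f r) :> int.
  rewrite (bigD1_seq s) ?fset_uniq//=; last by rewrite fpowersetE.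
  rewrite -big_filter (bigD1_seq fset0)/= ?filter_uniq ?fset_uniq//; last first.
    by rewrite mem_filter eq_sym s0/= fpowersetE fsub0set.
  rewrite big_filter_cond; congr (_ + (_ + _)).
  by apply: eq_bigl => r; rewrite /P andbC.
(* This is [sum_signs_eq0] with the terms of [s] and of the empty set taken out; the latter gives
   the 1. *)
have -> : (-1) ^+ #|` s|.-1 = 1 - \sum_(r <- fpowerset s | P r) (-1 : int) ^+ #|` r|.-1.
  have := sum_signs_eq0 s0; rewrite sumE cardfs0 expr0 signS// => e.
  rewrite (_ : \sum_(r <- fpowerset s | P r) (-1 : int) ^+ #|` r|.-1 =
    - \sum_(r <- fpowerset s | P r) (-1) ^+ #|` r|); first by
    rewrite opprK; apply/eqP; rewrite eq_sym -addr_eq0 addrC e.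
  by rewrite -sumrN; apply: eq_bigr => r /andP[r0 _]; rewrite signS.
have hs : has_euler anyset (indi (hull s)) 1.
  have [x sx] := open_hull_neq0 s0.
  rewrite -(inhab1 (open_hull_sub sx)); apply: has_euler_cconv => //; exact: cconv_hull.
have ho : has_euler anyset (fun x => \sum_(r <- fpowerset s | P r) indi (open_hull r) x)
    (\sum_(r <- fpowerset s | P r) (-1 : int) ^+ #|` r|.-1).
  apply: has_euler_sum => r; rewrite fpowersetE => rs /andP[r0 rNs].
  apply: IH => //; last exact: fsubset_trans rs st.
  by rewrite -ltnS (leq_trans _ sk)// ltnS fproper_ltn_card// fproperEneq rNs.
apply: has_euler_ext (has_eulerB hs ho) => x.
rewrite (@sum_indi_disjoint _ (fpowerset s) (fun r => r != fset0)
  (@open_hull R) (hull s)) ?fset_uniq//.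
- rewrite (bigID (fun r => r == s))/= [X in _ + X - _](eq_bigl P)// addrK.
  rewrite -big_filter (_ : [seq r <- _ | _] = [:: s]) ?big_seq1//.
  apply/perm_small_eq => //; apply: uniq_perm; rewrite ?filter_uniq ?fset_uniq//.
  move=> r; rewrite mem_filter inE fpowersetE.
  by have [->|] := eqVneq r s; rewrite ?andbF// s0 fsubset_refl.
- move=> r r'; rewrite !fpowersetE => rs r's xr xr'; apply/eqP; rewrite eqEfsubset.
  have rt := fsubset_trans rs st; have r't := fsubset_trans r's st.
  rewrite (open_hull_face_sub free rt r't xr (open_hull_sub xr')).
  by rewrite (open_hull_face_sub free r't rt xr' (open_hull_sub xr)).
- split=> [/hull_support[r [rs r0 xr]]|[r [rs _ xr]]].
    by exists r; rewrite fpowersetE.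
  by apply: hull_sub (open_hull_sub xr); rewrite -fpowersetE.
Qed.

(** The open simplices whose hull lies in the carrier partition it: [foam_complex] makes them
    disjoint, and the support of a point gives the one containing it. Adding up their integrals
    returns the alternating count [euler]. *)
Lemma has_euler_carrier (F : foam R) (T : {fset otri R}) :
  (T `<=` triangles F)%fset ->
  has_euler anyset (indi (carrier T)) (euler F (carrier T)).
Proof.
move=> /fsubsetP TF.
have simpP s : s \in simplices F -> exists2 t, t \in triangles F &
    (s `<=` verts t)%fset && (s != fset0).
  move=> /bigfcupP[t]; rewrite andbT => tF; rewrite in_fsetD fpowersetE inE => /andP[s0 st].
  by exists t; rewrite ?st.
have h : has_euler anyset
    (fun x => \sum_(s <- simplices F | `[< hull s `<=` carrier T >]) indi (open_hull s) x)
    (euler F (carrier T)).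
  apply: has_euler_sum => s /simpP[t tF /andP[st s0]] _.
  exact: has_euler_open_hull (foam_nondegenerate (foamP F) tF) st s0.
apply: has_euler_ext h => x; apply/esym/sum_indi_disjoint; first exact: fset_uniq.
- move=> s s' /simpP[t tF /andP[st _]] /simpP[t' t'F /andP[s't' _]] sx s'x.
  apply/eqP; rewrite eqEfsubset.
  rewrite (open_hull_complex (foamP F) tF t'F st s't' sx (open_hull_sub s'x)).
  by rewrite (open_hull_complex (foamP F) t'F tF s't' st s'x (open_hull_sub sx)).
- split=> [[t /= tT /hull_support[r [rt r0 rx]]]|[s [_ /asboolP sT sx]]].
    exists r; split=> //; last by apply/asboolP => y ry; exists t => //; exact: hull_sub ry.
    apply/bigfcupP; exists t; first by rewrite andbT TF.
    by rewrite in_fsetD fpowersetE inE rt r0.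
  exact/sT/open_hull_sub.
Qed.

(** The class of sets on which a map that is affine on each hull of [P] is affine. *)
Definition in_piece (P : seq {fset pt R}) A := exists2 s, s \in P & A `<=` hull s.

Lemma has_euler_sub (D D' : set (pt R) -> Prop) f n : (forall A, D A -> D' A) ->
  has_euler D f n -> has_euler D' f n.
Proof. by move=> DD' [l [lc fl nl]]; exists l; split=> // q /lc[? /DD']. Qed.

(** Inclusion-exclusion over the hulls in [P] rewrites the indicator of [Q] by convex sets that each
    lie in one piece; by uniqueness the integral is still [inhab Q]. *)
Lemma has_euler_pieces (P : seq {fset pt R}) Q : cconv Q ->
  Q `<=` \bigcup_(s in [set` P]) hull s ->
  has_euler (in_piece P) (indi Q) (inhab Q).
Proof.
move=> cQ QP; pose U (P' : seq {fset pt R}) := \bigcup_(s in [set` P']) hull s : set (pt R).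
suff [m hm] : exists m, has_euler (in_piece P) (indi (Q `&` U P)) m.
  rewrite setIidl// in hm; have h1 := has_euler_sub (D' := anyset) (fun _ _ => I) hm.
  by rewrite -(has_euler_uniq h1 (has_euler_cconv cQ I)).
have : {subset P <= P} by [].
(* The union is taken over a sublist [P'], while the class remains that of the whole list. *)
move: {1 4}P => P'; elim: P' Q cQ {QP} => [|s P' IH] Q cQ sub.
  exists 0; apply: has_euler_ext (has_euler0 _) => x.
  by rewrite /indi asboolF// => -[_ []].
have {}IH := IH _ _ (fun r rP' => sub r (mem_behead (rP' : r \in behead (s :: P')))).
have [m1 h1] := IH _ cQ; have [m2 h2] := IH _ (cconvI cQ (cconv_hull s)).
have h3 : has_euler (in_piece P) (indi (Q `&` hull s)) (inhab (Q `&` hull s)).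
  apply: has_euler_cconv; first exact: cconvI (cconv_hull s).
  by exists s; [apply: sub; exact: mem_head|exact: subIsetr].
eexists; apply: has_euler_ext (has_eulerB (has_eulerD h3 h1) h2) => x.
have UE : U (s :: P') x <-> hull s x \/ U P' x.
  split=> [[r /=]|[sx|[r /= rP' rx]]].
  - by rewrite inE => /predU1P[->|rP'] rx; [left|right; exists r].
  - by exists s => //=; exact: mem_head.
  - by exists r => //=; rewrite inE rP' orbT.
have IE A B : `[< (A `&` B) x >] = `[< A x >] && `[< B x >] by exact: asbool_and.
rewrite /indi !IE (asbool_equiv_eq UE) asbool_or.
by case: (asbool (Q x)); case: (asbool (hull s x)); case: (asbool (U P' x)).
Qed.

(** Each summand lies in a piece where [f] is affine, so its image is compact, convex and nonempty
    exactly when it is; injectivity on [X] makes the indicator of the image at [f x] equal to the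
    original one at [x]. *)
Lemma has_euler_pushforward (f : pt R -> pt R) (P : seq {fset pt R}) X h n :
  X = \bigcup_(s in [set` P]) hull s ->
  (forall s, s \in P -> affine_on f (hull s)) -> {in X &, injective f} ->
  has_euler (in_piece P) h n ->
  exists g, [/\ has_euler anyset g n, forall x, X x -> g (f x) = h x
    & forall y, ~ (f @` X) y -> g y = 0].
Proof.
move=> XE af injf [l [lc hl ->]].
have lX q : q \in l -> q.2 `<=` X.
  by move=> /lc[_ [s sP qs]] x /qs sx; rewrite XE; exists s.
exists (fun y => \sum_(q <- l) q.1 * indi (f @` q.2) y); split.
- exists [seq (q.1, f @` q.2) | q <- l]; split.
  + move=> _ /mapP[q /lc[[cq vq] [s sP qs]] ->]; split=> //=; split.
      rewrite -(setIidr qs); apply: affine_image_compact; first exact: af.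
      exact: compact_closed_pt.
    exact: affine_image_convexs (af _ sP) qs vq.
  + by move=> y; rewrite big_map.
  + rewrite big_map; apply: eq_bigr => q _; congr (_ * (nat_of_bool _)%:R).
    apply: asbool_equiv_eq; split=> [[x qx]|[_ [x qx _]]]; last by exists x.
    by exists (f x), x.
- move=> x Xx; rewrite hl !big_seq; apply: eq_bigr => q ql.
  congr (_ * (nat_of_bool _)%:R); apply: asbool_equiv_eq; split=> [[y qy fyx]|qx].
    by rewrite -(injf _ _ _ _ fyx) ?inE//; exact: lX qy.
  by exists x.
- move=> y nXy; rewrite big_seq big1// => q ql; rewrite /indi asboolF ?mulr0//.
  by move=> [x qx fx]; apply: nXy; exists x => //; exact: lX qx.
Qed.

End EulerFoams.

(** * The neck *)

Section NeckCutting.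
Context (R : realType).
Implicit Types (x y : pt R) (A X : set (pt R)).

Definition box (a0 b0 a1 b1 a2 b2 : R) : set (pt R) := [set x |
  [/\ a0 <= x 0 0 <= b0, a1 <= x 0 1 <= b1 & a2 <= x 0 2%:R <= b2]].

Lemma cconv_box a0 b0 a1 b1 a2 b2 : cconv (box a0 b0 a1 b1 a2 b2).
Proof.
pose l (j : 'I_3) := if j == 0 then a0 else if j == 1 then a1 else a2.
pose u (j : 'I_3) := if j == 0 then b0 else if j == 1 then b1 else b2.
have boxE : box a0 b0 a1 b1 a2 b2 = [set x : pt R | forall j, x ord0 j \in `[l j, u j]].
  apply/seteqP; split=> [x [h0 h1 h2] j|x h] /=.
    rewrite in_itv/= /l /u; case: eqP => [->//|/eqP j0]; case: eqP => [->//|/eqP j1].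
    have -> : j = 2%:R; last by [].
    by apply/val_inj; move: j j0 j1 => [[|[|[|]]]].
  by split; [have := h 0|have := h 1|have := h 2%:R]; rewrite in_itv.
split; last first.
  move=> x y k [x0 x1 x2] [y0 y1 y2] /andP[k0 k1].
  have cv (a b c d : R) : a <= c <= b -> a <= d <= b -> a <= k * c + (1 - k) * d <= b.
    by move=> /andP[? ?] /andP[? ?]; apply/andP; split; nra.
  by split; rewrite !mxE; exact: cv.
rewrite boxE.
exact: (@rV_compact _ 3 (fun j => `[l j, u j]%classic) (fun j => @segment_compact R (l j) (u j))).
Qed.

Lemma inhab_box a0 b0 a1 b1 a2 b2 : a0 <= b0 -> a1 <= b1 -> a2 <= b2 ->
  inhab (box a0 b0 a1 b1 a2 b2) = 1.
Proof.
move=> h0 h1 h2.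
apply: (@inhab1 R _ (\row_j if j == 0 then a0 else if j == 1 then a1 else a2)).
by split; rewrite !mxE/= lexx.
Qed.

Lemma indi_box a0 b0 a1 b1 a2 b2 x : indi (box a0 b0 a1 b1 a2 b2) x =
  [&& a0 <= x 0 0 <= b0, a1 <= x 0 1 <= b1 & a2 <= x 0 2%:R <= b2]%:R.
Proof. by congr (nat_of_bool _)%:R; apply/asboolP/and3P. Qed.

(** The tube over the boundary of a square is four rectangles glued along four vertical edges, of
    integral 4 - 4 = 0; the two end disks contribute 2. *)
Lemma has_euler_neck (P : seq {fset pt R}) :
  @solid_cylinder R = \bigcup_(s in [set` P]) hull s ->
  has_euler (in_piece P) (fun x => indi (@end_disks R) x - indi (@tube R) x) 2.
Proof.
have n1 (a : R) : (`|a| <= 1) = (-1 <= a <= 1) by rewrite ler_norml.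
have n2 (a : R) : (`|a| == 1) = (1 <= a <= 1) || (-1 <= a <= -1).
  by rewrite eqr_norml ler01 andbT ![_ == _]eq_le ![(a <= _) && _]andbC.
have n3 (a b : R) : (a == b) = (b <= a <= b) by rewrite eq_le andbC.
(* The pointwise identity depends only on the truth values of a few interval conditions; [impl] and
   [implh] exclude the combinations that cannot occur, which leaves a finite case check. *)
have impl (a : R) : [/\ (1 <= a <= 1) ==> (-1 <= a <= 1), (-1 <= a <= -1) ==> (-1 <= a <= 1)
   & ~~ ((1 <= a <= 1) && (-1 <= a <= -1))].
  split; [apply/implyP => /andP[? ?]; apply/andP; split; lra
         |apply/implyP => /andP[? ?]; apply/andP; split; lra|].
  by apply/negP => /andP[/andP[? ?] /andP[? ?]]; lra.
have implh (a : R) : ~~ ((0 <= a <= 0) && (1 <= a <= 1)).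
  by apply/negP => /andP[/andP[? ?] /andP[? ?]]; lra.
move=> PE.
have hb a0 b0 a1 b1 a2 b2 : -1 <= a0 <= b0 -> b0 <= 1 -> -1 <= a1 <= b1 -> b1 <= 1 ->
    0 <= a2 <= b2 -> b2 <= 1 ->
    has_euler (in_piece P) (indi (box a0 b0 a1 b1 a2 b2)) 1.
  move=> /andP[? ab0] ? /andP[? ab1] ? /andP[? ab2] ?.
  rewrite -(inhab_box ab0 ab1 ab2); apply: has_euler_pieces; first exact: cconv_box.
  rewrite -PE => x [/andP[? ?] /andP[? ?] /andP[? ?]]; split.
    by rewrite /rad ge_max !ler_norml; apply/andP; split; apply/andP; split; lra.
  by rewrite /height; apply/andP; split; lra.
pose D h := indi (box (-1) 1 (-1) 1 h h).
pose side (d : bool) (s : R) :=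
  if d then indi (box s s (-1) 1 0 1) else indi (box (-1) 1 s s 0 1).
pose edge (s s' : R) := indi (box s s s' s' 0 1).
have -> : (2 : int) = 1 + 1 - (1 + 1 + (1 + 1) - (1 + 1 + (1 + 1))) by [].
have e : (fun x => D 0 x + D 1 x - (side true 1 x + side true (-1) x +
      (side false 1 x + side false (-1) x) -
      (edge 1 1 x + edge 1 (-1) x + (edge (-1) 1 x + edge (-1) (-1) x)))) =1
    (fun x => indi (@end_disks R) x - indi (@tube R) x).
  move=> x; rewrite /D /side /edge !indi_box.
  have tE : indi (@tube R) x = [&& (`|x 0 0| == 1) && (`|x 0 1| <= 1) ||
      (`|x 0 1| == 1) && (`|x 0 0| <= 1) & 0 <= x 0 2%:R <= 1]%:R.
    congr (nat_of_bool _)%:R; apply/asboolP/andP => [[r h]|[r h]]; split=> //.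
      move: r; rewrite /rad => r; have : `|x 0 0| <= 1 /\ `|x 0 1| <= 1.
        by rewrite -r !le_max !lexx orbT.
      move: r; rewrite maxEle; case: ifP => _ -> [-> ->]; rewrite eqxx ?orbT//.
    by rewrite /rad; case/orP: r => /andP[/eqP e h']; [rewrite max_l|rewrite max_r] => //;
       rewrite e.
  have dE : indi (@end_disks R) x = [&& `|x 0 0| <= 1, `|x 0 1| <= 1 &
      (x 0 2%:R == 0) || (x 0 2%:R == 1)]%:R.
    congr (nat_of_bool _)%:R; apply/asboolP/and3P => [[+ h]|[r r' h]].
      by rewrite /rad ge_max => /andP[]; split=> //; apply/orP;
        case: h; rewrite /height => ->; rewrite eqxx; auto.
    by split; [rewrite /rad ge_max r r'|case/orP: h => /eqP; auto].
  rewrite tE dE.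
  rewrite !n1 !n2 !n3.
  move: (impl (x 0 0)).
  move: (1 <= x 0 0 <= 1) (-1 <= x 0 0 <= -1) (-1 <= x 0 0 <= 1) => [] [] [] [] //= _ _ _;
  move: (impl (x 0 1));
  move: (1 <= x 0 1 <= 1) (-1 <= x 0 1 <= -1) (-1 <= x 0 1 <= 1) => [] [] [] [] //= _ _ _;
  move: (implh (x 0 2%:R));
  by move: (0 <= x 0 2%:R <= 0) (1 <= x 0 2%:R <= 1) (0 <= x 0 2%:R <= 1) => [] [] [].
apply: has_euler_ext e _.
apply: has_eulerB; first by apply: has_eulerD; apply: hb; rewrite ?lexx ?ler01//; lra.
by apply: has_eulerB; do ! apply: has_eulerD; apply: hb; try (apply/andP; split); lra.
Qed.

End NeckCutting.

(** * Evaluation *)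

Section Evaluation.
Context (R : realType).
Implicit Types (x y : pt R) (A X W : set (pt R)).

(** Adding 2 raises the integer quotient by exactly 1, whatever the parity. *)
Lemma half_eulerS (F F1 : foam R) A A1 : euler F A = euler F1 A1 + 2 ->
  half_euler F A = half_euler F1 A1 + 1.
Proof.
by move=> e; rewrite /half_euler e addrC -[X in (X + _)%R]mul1r divzMDl// addrC.
Qed.

Definition thin_part (F : foam R) (c : precoloring F) (i : bool) : set (pt R) :=
  \bigcup_(C in [set C | c C = i]) closure (val C).

Lemma colored_partE (F : foam R) (c : precoloring F) i :
  colored_part c i = thin_part c i `|` carrier (double F).
Proof. by rewrite /colored_part double_closures. Qed.

Lemma thin_part_sub (F : foam R) (c : precoloring F) i :
  thin_part c i `<=` carrier (thin F).
Proof.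
move=> x [C _ Cx]; have [_ CT] := thin_facet_val C.
exact: closure_subset_closed (@carrier_closed R (thin F)) CT _ Cx.
Qed.

(** Writing the colored surface as a union of triangles of [F] makes [has_euler_carrier] applicable
    to it. *)
Lemma colored_part_carrier (F : foam R) (c : precoloring F) i :
  exists2 T, (T `<=` triangles F)%fset & colored_part c i = carrier T.
Proof.
exists [fset t in triangles F | `[< t \in double F \/
  exists2 C : fset_set (thin_facets F), c C = i & (open_hull (verts t) `<=` val C)%classic >]]%fset.
  by apply/fsubsetP => t; rewrite 2!inE => /andP[].
rewrite colored_partE; apply/seteqP; split=> [x [[C cC]|[t /= tD tx]]|x [t /=]].
- move=> /(facet_closure x (proj1 (thin_facet_val C)))[t [tF tC tx]].
  exists t => //=; rewrite 2!inE/= tF; apply/asboolP; right; by exists C.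
- by exists t => //=; rewrite 2!inE/= double_sub//; apply/asboolP; left.
- rewrite 2!inE/= => /andP[tF /asboolP[tD|[C cC tC]]] tx; first by right; exists t.
  left; exists C => //; apply/(facet_closure x (proj1 (thin_facet_val C))).
  by exists t.
Qed.

(** Here [s], [t] are the signs, [d1], [d2] the dot monomials, and [u], [v] the powers of [p] and
    [q] before the cut. The extra [-1], [p] and [q] come from the two half Euler characteristics
    growing by 1. *)
Lemma cut_factor (A : comUnitRingType) (s t d1 d2 u v p q w : A) :
  s * t * -1 * (d1 * d2 * (u * p) * (v * q) / w) =
  - (p * q) * (s * t * (d1 * d2 * u * v / w)).
Proof. by ring. Qed.

(** Precolorings of the two foams have different types, indexed by sets that are only provably
    equal; with [T] and [T'] as variables the equality can be eliminated. *)
Lemma transport_coloring (T T' : {fset set (pt R)}) : T = T' ->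
  exists tr : {ffun T' -> bool} -> {ffun T -> bool}, bijective tr /\
    forall c (C : T) (C' : T'), val C = val C' -> tr c C = c C'.
Proof.
move=> ->; exists id; split; first by exists id.
by move=> c C C' /val_inj ->.
Qed.

(** Half Euler characteristics may be negative, and adding integer exponents asks for a nonzero
    base. *)
Lemma tofrac_ps2_neq0 (a : nat -> nat -> kring) : a 0%N 0%N = 1 ->
  tofrac (ps2 a) != 0 :> evalring.
Proof.
move=> a1; rewrite tofrac_eq0; apply/eqP => /(congr1 (fun f => fcoef (fcoef f 0%N) 0%N)).
by move=> /= /eqP; rewrite a1 oner_eq0.
Qed.

Lemma beta00 : beta 0 0 = 1.
Proof. by rewrite /beta insubF. Qed.

(** * A foam and its cut along a double neck *)

Section Cut.
Context (F1 F : foam R) (phi : pt R -> pt R).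
Context (hneck : double_neck F1 phi) (hcut : neck_cut F1 phi F).

Let K := phi @` @solid_cylinder R.

Lemma open_tube_cylinder : @open_tube R `<=` @solid_cylinder R.
Proof.
by move=> x [r /andP[h0 h1]]; split; [rewrite r|rewrite (ltW h0) (ltW h1)].
Qed.

Lemma end_disks_cylinder : @end_disks R `<=` @solid_cylinder R.
Proof. by move=> x [r h]; split=> //; case: h => ->; rewrite lexx ler01. Qed.

(** [K] is a finite union of affine images of compact hulls. *)
Lemma neck_closed : closed K.
Proof.
case: hneck => -[P PE af] _ _ _; rewrite /K PE image_bigcup.
apply: closed_bigcup => [|s sP]; first exact: finite_seq.
apply: compact_closed_pt; rewrite -[hull s]setIT.
by apply: affine_image_compact; [exact: af|exact: closedT].
Qed.

(** The body of [F1] meets [K] within the tube, hence within a double facet. A thin point there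
    would be both thin and double, that is singular, but facets avoid the singular locus. *)
Lemma thin_off_neck x : carrier (thin F1) x -> ~ K x.
Proof.
case: hneck => _ _ [C [fC Cd] tC] bK tx Kx.
have Cx : C x by apply/tC/bK; split=> //; rewrite bodyE; left.
have [_ /(_ _ Cx)[_]] := facet_sub fC; apply.
by rewrite (singular_locusE (foamP F1)); split=> //; exact: Cd.
Qed.

Lemma cut_thin : carrier (thin F) = carrier (thin F1).
Proof. by case: hcut. Qed.

Lemma cut_double_off x : ~ K x -> carrier (double F) x <-> carrier (double F1) x.
Proof.
case: hcut => _ -> _ _ nK; split=> [[[]//|[y ey yx]]|dx].
  by case: nK; exists y => //; exact: end_disks_cylinder.
left; split=> // -[y oy yx]; apply: nK; exists y => //; exact: open_tube_cylinder.
Qed.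

Lemma cut_singular : singular_locus F = singular_locus F1.
Proof.
rewrite !(singular_locusE (foamP _)) cut_thin; apply/seteqP.
by split=> x [tx dx]; split=> //; apply/cut_double_off => //; exact: thin_off_neck.
Qed.

Lemma cut_thin_facets : thin_facets F = thin_facets F1.
Proof. by rewrite !thin_facetsE cut_thin cut_singular. Qed.

(* Along the neck, [F1] meets the solid cylinder in the tube and [F] in the end
   disks; elsewhere the two sets agree. *)
Lemma euler_cut W (T T1 : {fset otri R}) :
  W `<=` carrier (thin F1) ->
  (T `<=` triangles F)%fset -> (T1 `<=` triangles F1)%fset ->
  carrier T = W `|` carrier (double F) -> carrier T1 = W `|` carrier (double F1) ->
  euler F (carrier T) = euler F1 (carrier T1) + 2.
Proof.
move=> WT TF TF1 TE TE1; case: (hneck) => -[P PE af] injphi [C [fC Cd] tC] bK.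
have [g [g2 gX g0]] := has_euler_pushforward PE af injphi (has_euler_neck PE).
apply: has_euler_uniq (has_euler_carrier TF) _.
apply: has_euler_ext (has_eulerD (has_euler_carrier TF1) g2) => y.
rewrite TE TE1; have [Ky|nK] := pselect (K y); last first.
  rewrite g0// addr0; congr (nat_of_bool _)%:R; apply: asbool_equiv_eq.
  by split=> -[Wy|dy]; [left|right; apply/cut_double_off|left|right; apply/cut_double_off].
have [x xX xy] := Ky.
rewrite -xy gX//.
(* Inside [K] the surface in [F1] is exactly the tube, by injectivity of [phi]; [W] is thin and does
   not reach [K]. *)
have -> : indi (W `|` carrier (double F1)) (phi x) = indi (@tube R) x.
  congr (nat_of_bool _)%:R; apply: asbool_equiv_eq; split=> [Wd|tx].
    have [|z tz zx] := bK (phi x).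
      split; last by exists x.
      by rewrite bodyE; case: Wd => [/WT|]; [left|right].
    have zX : (@solid_cylinder R) z by case: tz => r h; split=> //; rewrite r.
    by rewrite -(injphi _ _ _ _ zx) ?inE.
  by right; apply/Cd/tC; exists x.
rewrite addrC subrK; congr (nat_of_bool _)%:R; apply: asbool_equiv_eq.
split=> [ex|[/WT/thin_off_neck[]|]].
- by right; case: (hcut) => _ -> _ _; right; exists x.
- by exists x.
(* What the cut keeps of the old double part inside [K] lies on the tube but not on the open tube,
   hence on one of the two boundary circles, which belong to the end disks. *)
case: (hcut) => _ -> _ _ [[dx nox]|[z ez zx]]; last first.
  by rewrite -(injphi _ _ _ _ zx) ?inE//; exact: end_disks_cylinder.
have [|z tz zx] := bK (phi x).
  by split; [rewrite bodyE; right|exists x].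
have zX : (@solid_cylinder R) z by case: tz => r h; split=> //; rewrite r.
have zE : z = x by apply: injphi; rewrite ?inE.
rewrite {}zE in tz; case: tz => r /andP[h0 h1]; split; first by rewrite r.
move: h0; rewrite le_eqVlt => /predU1P[->|h0]; first by left.
move: h1; rewrite le_eqVlt => /predU1P[->|h1]; first by right.
by case: nox; exists x => //; split=> //; rewrite h0.
Qed.

Lemma foam_eval_cut : foam_eval F = rho * foam_eval F1.
Proof.
have finT : fset_set (thin_facets F) = fset_set (thin_facets F1) by rewrite cut_thin_facets.
have [tr [bij trE]] := transport_coloring finT.
have corr (C1 : fset_set (thin_facets F1)) :
    exists C : fset_set (thin_facets F), val C = val C1.
  have CT : val C1 \in fset_set (thin_facets F) by rewrite finT; exact: valP.
  by exists [` CT]%fset.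
have corr' (C : fset_set (thin_facets F)) :
    exists C1 : fset_set (thin_facets F1), val C = val C1.
  have CT : val C \in fset_set (thin_facets F1) by rewrite -finT; exact: valP.
  by exists [` CT]%fset.
rewrite /foam_eval mulr_sumr (reindex tr) /=; last exact: onW_bij.
apply: eq_big => [c|c _].
  apply: asbool_equiv_eq; rewrite !is_coloringP cut_singular.
  split=> col x i xS; have [C Ci Cx] := col x i xS.
    have [C1 CC1] := corr' C; exists C1; last by rewrite -CC1.
    by rewrite -(trE c C).
  have [C0 CC0] := corr C; exists C0; last by rewrite CC0.
  by rewrite (trE c C0 C).
have thinE i : thin_part (tr c) i = thin_part c i.
  apply/seteqP; split=> x [C cC Cx].
    have [C1 CC1] := corr' C; exists C1; last by rewrite -CC1.
    by rewrite /= -(trE c C).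
  have [C0 CC0] := corr C; exists C0; last by rewrite CC0.
  by rewrite /= (trE c C0 C).
have dotsE i : num_dots (tr c) i = num_dots c i.
  case: hcut => _ _ _ /permP perm; rewrite /num_dots perm; apply: eq_count => x.
  apply: asbool_equiv_eq; split=> [[C cC Cx]|[C cC Cx]].
    by have [C1 CC1] := corr' C; exists C1; rewrite -?(trE c C)// -CC1.
  by have [C0 CC0] := corr C; exists C0; rewrite ?(trE c C0 C)// CC0.
(* The two sets are equal, but each [euler] counts simplices of its own triangulation. *)
have h12 : half_euler F (carrier (thin F)) = half_euler F1 (carrier (thin F1)).
  congr (_ %/ 2)%Z; apply: has_euler_uniq (has_euler_carrier _) _.
    by apply/fsubsetP => t; exact: thin_sub.
  rewrite cut_thin; apply: has_euler_carrier.
  by apply/fsubsetP => t; exact: thin_sub.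
have hi i : half_euler F (colored_part (tr c) i) = half_euler F1 (colored_part c i) + 1.
  apply: half_eulerS; have [T TF TE] := colored_part_carrier (tr c) i.
  have [T1 TF1 TE1] := colored_part_carrier c i; rewrite TE TE1.
  apply: (euler_cut (W := thin_part c i)) => //; first exact: thin_part_sub.
    by rewrite -TE colored_partE thinE.
  by rewrite -TE1 colored_partE.
have thetaE : theta_plus (tr c) = theta_plus c.
  congr (#|` fset_set _|); apply/seteqP.
  have circ : singular_circles F = singular_circles F1.
    by rewrite /singular_circles cut_singular.
  have [_ _ ori _] := hcut.
  have S1K x : singular_locus F1 x -> ~ K x.
    by rewrite (singular_locusE (foamP F1)) => -[+ _]; exact: thin_off_neck.
  (* The orientation clause of [neck_cut] holds off the solid cylinder, so it covers all thin
     triangles. *)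
  split=> Z /= [sZ pZ]; split; rewrite ?circ// -?circ//.
  - apply: (positive_transfer neck_closed _ cut_singular cut_thin _ _ (trE c) sZ pZ).
    + by move=> x; rewrite cut_singular; exact: S1K.
    + by move=> x [dx nK]; apply/cut_double_off.
    + move=> t t1 x tT t1T tx t1x; apply: (ori t t1 x) => //; try exact: thin_sub.
      by apply: thin_off_neck; exists t1 => //; exact: open_hull_sub.
  - apply: (positive_transfer neck_closed S1K (esym cut_singular) (esym cut_thin) _ _ _ sZ pZ).
    + by move=> x [dx nK]; apply/cut_double_off.
    + move=> t t1 x tT t1T tx t1x; apply: same_orientation_sym.
      apply: (ori t1 t x) => //; try exact: thin_sub.
      by apply: thin_off_neck; exists t => //; exact: open_hull_sub.
    + by move=> C C' CC'; apply/esym/trE.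
rewrite /eval_coloring !dotsE h12 !hi thetaE.
set th := (theta_plus c)%:Z; set e1 := half_euler F1 _; set e2 := half_euler F1 _.
have p1 : p12 != 0 by apply: tofrac_ps2_neq0; exact: beta00.
have p2 : p21 != 0 by apply: tofrac_ps2_neq0; exact: beta00.
have n1 : -1 != 0 :> evalring by rewrite oppr_eq0 oner_eq0.
rewrite addrA !(expfzDr _ _ n1) (expfzDr _ _ p1) (expfzDr _ _ p2) !expr1z.
exact: cut_factor.
Qed.

End Cut.
End Evaluation.

Theorem proposition4p11 (R : realType) (F1 F : foam R) (phi : pt R -> pt R)
    (hneck : double_neck F1 phi) (hcut : neck_cut F1 phi F) :
  foam_eval F = rho * foam_eval F1.
Proof. exact: foam_eval_cut hneck hcut. Qed.
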